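(* The following hold. (1) For every finitely generated group $\Gamma$ and every sofic approximation $\mathcal{G}$ of $\Gamma$: if $\mathcal{G}$ has property A, then $\Gamma$ is amenable. The converse does not hold: there exist a finitely generated amenable group $\Gamma$ and a sofic approximation $\mathcal{G}$ of $\Gamma$ that does not have property A. (2) For every finitely generated group $\Gamma$ and every sofic approximation $\mathcal{G}$ of $\Gamma$: if $\mathcal{G}$ is hyperfinite, then $\Gamma$ is amenable. The converse also holds: if $\Gamma$ is amenable, then $\mathcal{G}$ is hyperfinite.
   Context: A graph sequence $\mathcal{G}=\{G_n\}_{n\in\mathbb{N}}$ is a sequence of finite connected graphs whose vertex degrees are bounded by a constant $d$ independent of $n$, with $\lim_{n\to\infty}|V(G_n)|=\infty$. Here $V(G)$ and $E(G)$ denote vertex and edge sets; each graph carries its path metric (ignoring orientations). Let $\Gamma$ be a group with finite generating set $S$. Its Cayley graph $Cay(\Gamma,S)$ has vertex set $\Gamma$ and a directed edge labelled $s$ from $g$ to $gs$ for each $s\in S$. A graph sequence $\mathcal{G}=\{G_n\}$ with directed edges labelled by $S$ is a sofic approximation of $\Gamma$ if it Benjamini–Schramm converges to $Cay(\Gamma,S)$: for every $r\in\mathbb{N}$, the proportion of vertices $x\in V(G_n)$ such that the ball $B_r(G_n,x)$ is isomorphic, as a rooted edge-labelled (directed) graph, to the ball $B_r(Cay(\Gamma,S),e)$ around the identity tends to $1$ as $n\to\infty$. Property A: $\mathcal{G}=\{G_n\}$ has property A if for every $\epsilon>0$ there exist $S_0>0$ and a function $\xi:\bigsqcup_n V(G_n)\to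 \ell^1(\bigsqcup_n V(G_n))$, $x\mapsto\xi_x$, such that (1) $\|\xi_x\|_1=1$ for all $x$; (2) $\xi_x$ is supported in the ball of radius $S_0$ about $x$ (vertices of different graphs being regarded as infinitely far apart); (3) $\|\xi_x-\xi_y\|_1<\epsilon$ whenever $(x,y)$ is an edge of some $G_n$. Hyperfiniteness: $\mathcal{G}$ is hyperfinite if for every $\epsilon>0$ there exist a constant $K>0$ and edge sets $E_n^\epsilon\subset E(G_n)$ ($n\in\mathbb{N}$) such that $\lim_{n\to\infty}\frac{|E_n^\epsilon|}{|V(G_n)|}<\epsilon$ and, for every $n$, each connected component of $G_n\setminus E_n^\epsilon$ contains at most $K$ vertices. *)

(* Defs.v *)
From HB Require Import structures.
From mathcomp Require Import all_boot all_order all_algebra finmap.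
From mathcomp Require Import all_classical all_reals all_analysis.
Import Order.TTheory GRing.Theory Num.Theory.
Import numFieldNormedType.Exports.
Set Implicit Arguments.
Unset Strict Implicit.
Unset Printing Implicit Defensive.

Local Open Scope classical_set_scope.
Local Open Scope ring_scope.

(* A directed graph on [V] with edges labelled by [L] is a family
   [G : L -> rel V]: [G s x y] says that there is an [s]-labelled edge from
   [x] to [y]. Loops, and parallel edges with different labels, are allowed. *)
Section LabelledGraphs.
Variable L : finType.

Definition linked (V : Type) (G : L -> rel V) : rel V :=
  fun x y => [exists s, G s x y || G s y x].

(* closed ball of the path metric of the underlying undirected graph *)
Definition graph_ball (V : eqType) (G : L -> rel V) (x : V) (r : nat) : set V :=
  [set y | exists p : seq V,
     [/\ path (linked G) x p, last x p = y & (size p <= r)%N]].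

(* The balls of radius [r] about [x] and [y], with all the edges between their
   vertices, are isomorphic as rooted labelled directed graphs. *)
Definition iso_balls (V W : eqType) (G : L -> rel V) (H : L -> rel W)
    (r : nat) (x : V) (y : W) : Prop :=
  exists f : V -> W,
    [/\ f x = y,
        set_bij (graph_ball G x r) (graph_ball H y r) f
      & forall s u v, graph_ball G x r u -> graph_ball G x r v ->
          G s u v = H s (f u) (f v)].

(* out-degree plus in-degree *)
Definition degree (V : finType) (G : L -> rel V) (x : V) : nat :=
  (\sum_(s : L) (#|[pred y | G s x y]| + #|[pred y | G s y x]|))%N.

Definition connected_graph (V : finType) (G : L -> rel V) : Prop :=
  (0 < #|V|)%N /\ forall x y, connect (linked G) x y.

(* the triple [(x, s, y)] stands for the [s]-labelled edge from [x] to [y] *)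
Definition edges (V : finType) (G : L -> rel V) : {set V * L * V} :=
  finset (fun e => G e.1.2 e.1.1 e.2).

Definition remove_edges (V : finType) (G : L -> rel V) (E : {set V * L * V}) :
    L -> rel V :=
  fun s x y => G s x y && ((x, s, y) \notin E).

Record graph_seq := GraphSeq {
  vtx : nat -> finType;
  labelled_edge : forall n, L -> rel (vtx n);
  graph_seq_connected : forall n, connected_graph (@labelled_edge n);
  graph_seq_degree : exists d : nat, forall n x, (degree (@labelled_edge n) x <= d)%N;
  graph_seq_size : (fun n => #|vtx n|) @ \oo --> \oo
}.

Definition all_vtx (G : graph_seq) : choiceType := {n : nat & vtx G n}.

Definition in_vtx (G : graph_seq) (n : nat) (x : vtx G n) : all_vtx G :=
  existT (fun n => vtx G n : Type) n x.

Definition propertyA (R : realType) (G : graph_seq) : Prop :=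
  forall eps : R, 0 < eps ->
  exists S0 : nat, (0 < S0)%N /\
  exists xi : all_vtx G -> all_vtx G -> R,
    [/\ forall x, (\esum_(z in [set: all_vtx G]) `|xi x z|%:E = 1)%E,
        forall n (x : vtx G n) z, xi (in_vtx x) z != 0 ->
          exists2 y : vtx G n, graph_ball (@labelled_edge G n) x S0 y & z = in_vtx y
      & forall n s (x y : vtx G n), labelled_edge s x y ->
          (\esum_(z in [set: all_vtx G])
             `|xi (in_vtx x) z - xi (in_vtx y) z|%:E < eps%:E)%E].

Definition hyperfinite (R : realType) (G : graph_seq) : Prop :=
  forall eps : R, 0 < eps ->
  exists K : nat, (0 < K)%N /\
  exists E : forall n, {set vtx G n * L * vtx G n},
    [/\ forall n, E n \subset edges (@labelled_edge G n),
        exists2 l : R, l < eps &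
          (fun n => #|E n|%:R / #|vtx G n|%:R : R) @ \oo --> l
      & forall n (x : vtx G n),
          (#|connect (linked (remove_edges (@labelled_edge G n) (E n))) x| <= K)%N].

End LabelledGraphs.

Section Groups.
Variable Gam : groupType.

Definition generates (S : {fset Gam}) : Prop :=
  forall H : {pred Gam}, group_closed H -> {subset S <= H} ->
  forall g, g \in H.

Definition cayley (S : {fset Gam}) : S -> rel Gam :=
  fun s g h => h == (g * val s)%g.

Definition sofic_approximation (R : realType) (S : {fset Gam})
    (G : graph_seq S) : Prop :=
  forall r : nat,
    (fun n => #|[pred x | `[< iso_balls (@labelled_edge _ G n) (@cayley S) r x 1%g >]]|%:R
              / #|vtx G n|%:R : R) @ \oo --> (1 : R).

(* existence of a left-invariant finitely additive probability measure
   defined on all subsets *)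
Definition amenable (R : realType) : Prop :=
  exists mu : set Gam -> R,
    [/\ forall A, 0 <= mu A,
        mu [set: Gam] = 1,
        forall A B, A `&` B = set0 -> mu (A `|` B) = mu A + mu B
      & forall g A, mu ((fun a => (g * a)%g) @` A) = mu A].

End Groups.

(* Main.v *)
(* If a sofic approximation carries, vertex by vertex, probabilities of uniformly
   bounded range which vary little along most edges (property A provides them, and
   so does the uniform distribution on the pieces of a hyperfinite partition),
   averaging x |-> x^-1 xi_x over the vertices x around which the graph looks like
   the Cayley graph gives almost invariant means on the group.

   Conversely, an invariant mean excludes paradoxical decompositions, so by Hall's
   theorem there are Folner sets F. Translates xF placed greedily in the graph, each
   cutting its trace out of what the previous ones left over, cover all but a small
   proportion of the vertices; counting pairs (x, v) with v in xF shows that at every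
   stage some translate has boundary small relative to what it newly covers.

   The counterexample attaches to a long directed path, which looks like the Cayley
   graph of Z, a comparatively small Cayley graph of the group generated by the
   matrices (1 3; 0 1) and (1 0; 3 1) mod p. Property A would give almost invariant
   means on Z^2 \ 0 for these matrices, which ping-pong forbids. *)

From HB Require Import structures.
Require Import Defs.
From mathcomp Require Import all_boot all_order all_fingroup all_algebra finmap.
From mathcomp Require Import all_classical all_reals all_analysis.
From mathcomp Require Import zify ring lra.
Import Order.TTheory GRing.Theory Num.Theory.
Import numFieldNormedType.Exports.
Set Implicit Arguments.
Unset Strict Implicit.
Unset Printing Implicit Defensive.

Local Open Scope classical_set_scope.
Local Open Scope ring_scope.

(** * Walks in graphs that locally look like a Cayley graph *)

Section Balls.
Variables (L : finType) (V : eqType) (G : L -> rel V).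
Implicit Types (x y z : V) (r : nat).

Lemma graph_ball0 x r : graph_ball G x r x.
Proof. by exists [::]. Qed.

Lemma graph_ball_le x y r r' : (r <= r')%N -> graph_ball G x r y -> graph_ball G x r' y.
Proof. by move=> le [p [pp lp sp]]; exists p; split=> //; exact: leq_trans le. Qed.

Lemma graph_ball_rcons x y z r :
  graph_ball G x r y -> linked G y z -> graph_ball G x r.+1 z.
Proof.
move=> [p [pp lp sp]] yz; exists (rcons p z).
by rewrite rcons_path pp lp last_rcons size_rcons.
Qed.

Lemma graph_ball_inv x z r : graph_ball G x r z ->
  x = z \/ exists2 y, graph_ball G x r.-1 y & (0 < r)%N && linked G y z.
Proof.
move=> [p []]; case/lastP: p => [|p y]; first by left.
rewrite rcons_path last_rcons size_rcons => /andP[pp lpy] <- sp; right.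
exists (last x p); last by rewrite (leq_trans _ sp).
by exists p; split=> //; move: sp; lia.
Qed.

Lemma linked_sym : symmetric (linked G).
Proof. by move=> x y; apply: eq_existsb => s; rewrite orbC. Qed.

End Balls.

Section Words.
Variables (Gam : groupType) (S : {fset Gam}).
Local Notation letter := (S * bool)%type.
Implicit Types (w : seq letter) (g : Gam) (l : letter).

Definition lval l : Gam := if l.2 then val l.1 else (val l.1)^-1%g.

Definition eval w : Gam := (\prod_(l <- w) lval l)%g.

Definition linv l : letter := (l.1, ~~ l.2).

Definition winv w := rev (map linv w).

Lemma eval_cat w w' : eval (w ++ w') = (eval w * eval w')%g.
Proof. exact: big_cat. Qed.

Lemma eval_rcons w l : eval (rcons w l) = (eval w * lval l)%g.
Proof. by rewrite -cats1 eval_cat /eval big_seq1. Qed.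

Lemma lval_linv l : lval (linv l) = (lval l)^-1%g.
Proof. by case: l => s []; rewrite /lval //= invgK. Qed.

Lemma size_winv w : size (winv w) = size w.
Proof. by rewrite size_rev size_map. Qed.

Lemma eval_winv w : eval (winv w) = (eval w)^-1%g.
Proof.
elim: w => [|l w IH]; first by rewrite /eval !big_nil invg1.
rewrite /winv /= rev_cons eval_rcons -/(winv w) IH lval_linv.
by rewrite [X in (_ = X^-1)%g]/eval big_cons invgM.
Qed.

Lemma linked_lval l g : linked (@cayley _ S) g (g * lval l)%g.
Proof.
case: l => s []; apply/existsP; exists s; rewrite /cayley /lval/= ?eqxx//.
by rewrite mulgVK eqxx orbT.
Qed.

Lemma generates_word g : generates S -> exists w, eval w = g.
Proof.
move=> gen; pose H : {pred Gam} := [pred g | `[< exists w, eval w = g >]].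
suff /asboolP : g \in H by [].
apply: gen => [|s sS]; last first.
  apply/asboolP; exists [:: ([` sS]%fset, true)].
  by rewrite /eval big_seq1.
split; first by apply/asboolP; exists [::]; rewrite /eval big_nil.
move=> _ _ /asboolP[w <-] /asboolP[w' <-]; apply/asboolP; exists (w ++ winv w').
by rewrite eval_cat eval_winv.
Qed.

End Words.

Section Walks.
Variables (Gam : groupType) (S : {fset Gam}) (V : finType) (G : S -> rel V).
Local Notation letter := (S * bool)%type.
Implicit Types (x y z : V) (w : seq letter) (l : letter).

Definition letter_edge l x y := if l.2 then G l.1 x y else G l.1 y x.

(** At an arbitrary vertex [pick] takes any edge with the given letter, and the walk stands still if
    there is none. Near a vertex with a Cayley ball the choice is forced. *)
Definition step x l := odflt x [pick y | letter_edge l x y].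

Definition walk x w := foldl step x w.

Lemma walk_cat x w w' : walk x (w ++ w') = walk (walk x w) w'.
Proof. exact: foldl_cat. Qed.

Lemma walk_rcons x w l : walk x (rcons w l) = step (walk x w) l.
Proof. by rewrite -cats1 walk_cat. Qed.

Lemma letter_edge_linked l x y : letter_edge l x y -> linked G x y.
Proof.
by case: l => s []; rewrite /letter_edge/= => e; apply/existsP; exists s; rewrite e ?orbT.
Qed.

Lemma linked_letter_edge x y : linked G x y -> exists l, letter_edge l x y.
Proof. by move=> /existsP[s /orP[]]; [exists (s, true)|exists (s, false)]. Qed.

Section Good.
Variables (r : nat) (x : V).
Hypothesis good : iso_balls G (@cayley _ S) r x 1%g.

(** Induction on the word. Surjectivity of the ball isomorphism provides the next edge, so [step]
    never falls back on its default, and the edge criterion identifies the endpoint. *)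
Lemma walk_iso_ex : exists f : V -> Gam,
  [/\ {in graph_ball G x r &, injective f},
      forall w, (size w <= r)%N ->
        graph_ball G x (size w) (walk x w) /\ f (walk x w) = eval w
    & forall l u v, graph_ball G x r u -> graph_ball G x r v ->
        letter_edge l u v = (f v == f u * lval l)%g].
Proof.
have [f [fx [fsub finj fsurj] fE]] := good.
have edgeE l u v : graph_ball G x r u -> graph_ball G x r v ->
    letter_edge l u v = (f v == f u * lval l)%g.
  move=> bu bv; case: l => s []; rewrite /letter_edge/lval/= fE// /cayley.
  by apply/eqP/eqP => ->; rewrite ?mulgK ?mulgVK.
exists f; split=> //; elim/last_ind => [|w l IH]; rewrite ?size_rcons.
  by rewrite /eval big_nil; split; [exact: graph_ball0|].
move=> sw; have [bw fw] := IH (ltnW sw).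
have bw' := graph_ball_le (ltnW sw) bw.
have [v bv fv] : exists2 v, graph_ball G x r v & f v = eval (rcons w l).
  suff /fsurj[v] : graph_ball (@cayley _ S) 1%g r (eval (rcons w l)) by exists v.
  apply: (@graph_ball_le _ _ _ _ _ (size (rcons w l))); first by rewrite size_rcons.
  elim/last_ind: (rcons w l) => [|u k IHu].
    by rewrite /eval big_nil; exact: graph_ball0.
  rewrite size_rcons eval_rcons; apply: graph_ball_rcons IHu _; exact: linked_lval.
rewrite walk_rcons /step; case: pickP => /= [y|none]; last first.
  by have := none v; rewrite edgeE// fv fw eval_rcons eqxx.
move=> e; have by1 : graph_ball G x (size w).+1 y.
  exact: graph_ball_rcons bw (letter_edge_linked e).
split=> //; move: e; rewrite edgeE//; last exact: graph_ball_le by1.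
by rewrite fw eval_rcons => /eqP.
Qed.

Lemma walk_eq w w' : (size w <= r)%N -> (size w' <= r)%N ->
  walk x w = walk x w' <-> eval w = eval w'.
Proof.
have [f [finj fw _]] := walk_iso_ex => sw sw'.
have [bw <-] := fw _ sw; have [bw' <-] := fw _ sw'.
by split=> [->//|]; apply: finj; apply/mem_set; [exact: graph_ball_le bw|exact: graph_ball_le bw'].
Qed.

(** The strict bound on [size w] keeps the neighbour [y] inside the ball, where injectivity
    applies. *)
Lemma walk_edge w l y : (size w < r)%N ->
  letter_edge l (walk x w) y = (y == walk x (rcons w l)).
Proof.
have [f [finj fw fE]] := walk_iso_ex => sw.
have [bw fwE] := fw _ (ltnW sw).
have [bwl fwlE] : graph_ball G x (size (rcons w l)) (walk x (rcons w l)) /\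
    f (walk x (rcons w l)) = eval (rcons w l) by apply: fw; rewrite size_rcons.
have bw' := graph_ball_le (ltnW sw) bw.
rewrite size_rcons in bwl; have bwl' := graph_ball_le sw bwl.
apply/idP/eqP => [e|->]; last by rewrite fE// fwlE fwE eval_rcons.
have bY : graph_ball G x r y.
  apply: graph_ball_le (graph_ball_rcons bw (letter_edge_linked e)); exact: sw.
apply: finj; rewrite ?inE//; apply/eqP; rewrite fwlE eval_rcons -fwE.
by rewrite -fE.
Qed.

Lemma ball_walk k y : (k <= r)%N -> graph_ball G x k y ->
  exists2 w, (size w <= k)%N & walk x w = y.
Proof.
elim: k y => [|k IH] y kr /graph_ball_inv[<-|[z bz]]; try by exists [::].
move=> /= /linked_letter_edge[l e]; have [w sw wz] := IH _ (ltnW kr) bz.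
exists (rcons w l); first by rewrite size_rcons.
by apply/esym/eqP; rewrite -walk_edge ?wz//; exact: leq_trans kr.
Qed.

(** This makes following a fixed word injective on good vertices: the inverse word brings each
    endpoint back. *)
Lemma walk_winv w : (size w + size w <= r)%N -> walk (walk x w) (winv w) = x.
Proof.
move=> sw; rewrite -walk_cat -[RHS]/(walk x [::]); apply/walk_eq => //.
  by rewrite size_cat size_winv.
by rewrite eval_cat eval_winv mulgV /eval big_nil.
Qed.

End Good.

End Walks.

(** * Hall's marriage theorem for infinite families of finite sets *)

Definition hall (I T : choiceType) (A : I -> {fset T}) : Prop :=
  forall J : {fset I}, (#|` J| <= #|` (\bigcup_(j <- J) A j)%fset|)%N.

Lemma bigfcup_mono (I T : choiceType) (A B : I -> {fset T}) (J K : {fset I}) :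
  {subset J <= K} -> (forall j, j \in J -> (A j `<=` B j)%fset) ->
  ((\bigcup_(j <- J) A j) `<=` \bigcup_(j <- K) B j)%fset.
Proof.
move=> JK AB; apply/fsubsetP => x /bigfcupP[j]; rewrite andbT => jJ xA.
by apply/bigfcupP; exists j; rewrite ?andbT ?JK//; apply: (fsubsetP (AB _ jJ)).
Qed.

(** For each [i], a chain member of least cardinality at [i] has there a value contained in that of
    every other member. One chain member realises these values at finitely many indices at once, and
    Hall's condition involves only finite [J]. *)
Lemma hall_chain (I T : choiceType) (C : set (I -> {fset T})) :
  C !=set0 -> (forall B, C B -> hall B) ->
  (forall B B', C B -> C B' ->
     (forall i, B i `<=` B' i)%fset \/ (forall i, B' i `<=` B i)%fset) ->
  exists2 M, hall M & forall B, C B -> forall i, (M i `<=` B i)%fset.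
Proof.
move=> [B0 CB0] hallC totC.
have /choice[m mP] : forall i, exists M, C M /\ forall B, C B -> (#|` M i| <= #|` B i|)%N.
  move=> i.
  have exk : exists k, `[< exists2 B, C B & #|` B i| = k >].
    by exists #|` B0 i|; apply/asboolP; exists B0.

  case: (ex_minnP exk) => k /asboolP[M CM Mk] kmin.
  exists M; split=> // B CB; rewrite Mk; apply: kmin; apply/asboolP; by exists B.
have sub_m B i : C B -> (m i i `<=` B i)%fset.
  move=> CB; have [Cm minm] := mP i.
  case: (totC _ _ Cm CB) => [//|Bm].
  have /eqP -> : m i i == B i; last exact: fsubset_refl.
  by rewrite eq_sym eqEfcard Bm minm.
exists (fun i => m i i); last by move=> B CB i; exact: sub_m.
move=> J; suff [B CB BJ] : exists2 B, C B & forall j, j \in J -> (B j `<=` m j j)%fset.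
  apply: leq_trans (hallC _ CB J) _; apply: fsubset_leq_card.
  exact: bigfcup_mono.
suff h : forall s : seq I, exists2 B, C B & forall j, j \in s -> (B j `<=` m j j)%fset.
  exact: (h J).
elim=> [|i s [B CB Bs]]; first by exists B0.
have [Cm _] := mP i; case: (totC _ _ CB Cm) => le.
  exists B => // j /[!inE] /predU1P[->|/Bs//]; exact: le.
exists (m i) => // j /[!inE] /predU1P[->|/Bs]; first exact: fsubset_refl.
exact: fsubset_trans.
Qed.

(* Rado's argument: in a minimal Hall family every member is a singleton,
   because two failing deletions [B i `\ x] and [B i `\ y] would contradict
   Hall's condition by submodularity of the cardinality. *)
Lemma hall_minimal (I T : choiceType) (B : I -> {fset T}) :
  hall B ->
  (forall B', hall B' -> (forall i, B' i `<=` B i)%fset -> forall i, B' i = B i) ->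
  forall i x y, x \in B i -> y \in B i -> x = y.
Proof.
move=> hB minB i x y xB yB; apply/eqP/negP => /negP nxy.
have del z : z \in B i -> exists2 J : {fset I}, i \notin J &
    (#|` ((B i `\ z) `|` \bigcup_(j <- J) B j)%fset| <= #|` J|)%N.
  move=> zB; pose B' k := if k == i then (B i `\ z)%fset else B k.
  have B'B k : (B' k `<=` B k)%fset.
    by rewrite /B'; case: eqP => [->|_]; rewrite ?fsubD1set ?fsubset_refl.
  have nh : ~ hall B'.
    move=> /minB /(_ B'B i); rewrite /B' eqxx => E.
    by move: zB; rewrite -E !inE eqxx.
  have [J /negP] : exists J : {fset I},
      ~ (#|` J| <= #|` (\bigcup_(j <- J) B' j)%fset|)%N by apply/existsNP.
  rewrite -ltnNge => ltJ.
  have iJ : i \in J.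
    apply/negP => niJ; move: (hB J); rewrite leqNgt => /negP; apply.
    apply: leq_ltn_trans ltJ; apply: fsubset_leq_card; apply: bigfcup_mono => // j jJ.
    by rewrite /B'; case: eqP jJ => [->|]; rewrite ?(negPf niJ) // => _ _; exact: fsubset_refl.
  exists (J `\ i)%fset; first by rewrite !inE eqxx.
  rewrite -ltnS; apply: leq_trans (_ : #|` J| <= _)%N; last first.
    by rewrite (cardfsD1 i J) iJ.
  apply: leq_ltn_trans ltJ; apply: fsubset_leq_card; apply/fsubsetP => t.
  rewrite inE => /orP[tB|/bigfcupP[j]].
    by apply/bigfcupP; exists i; rewrite ?iJ// /B' eqxx.
  rewrite !inE andbT => /andP[ji jJ] tB; apply/bigfcupP; exists j; rewrite ?jJ//.
  by rewrite /B' (negPf ji).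
have [J niJ leJ] := del _ xB; have [K niK leK] := del _ yB.
set P := (_ `|` _)%fset in leJ; set Q := (_ `|` _)%fset in leK.
have := cardfsUI P Q; have := cardfsUI J K.
(* As [x] and [y] differ, [P] and [Q] together contain all of [B i], which yields one element more
   than the cardinalities of [P] and [Q] allow. *)
have PU : (#|` (i |` (J `|` K))%fset| <= #|` (P `|` Q)%fset|)%N.
  apply: leq_trans (hB _) _; apply: fsubset_leq_card; apply/fsubsetP => t.
  move=> /bigfcupP[j]; rewrite !inE andbT => /predU1P[->|/orP[jJ|jK]] tB.
  - case: (eqVneq t x) => [->|ntx]; rewrite ?nxy ?tB ?xB ?ntx/= ?orbT//.
  - have -> : t \in (\bigcup_(j <- J) B j)%fset by apply/bigfcupP; exists j; rewrite ?jJ.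
    by rewrite ?orbT.
  - have -> : t \in (\bigcup_(j <- K) B j)%fset by apply/bigfcupP; exists j; rewrite ?jK.
    by rewrite ?orbT.
have PI : (#|` (J `&` K)%fset| <= #|` (P `&` Q)%fset|)%N.
  apply: leq_trans (hB _) _; apply: fsubset_leq_card; apply/fsubsetP => t.
  move=> /bigfcupP[j]; rewrite !inE andbT => /andP[jJ jK] tB.
  have -> : t \in (\bigcup_(j <- J) B j)%fset by apply/bigfcupP; exists j; rewrite ?jJ.
  have -> : t \in (\bigcup_(j <- K) B j)%fset by apply/bigfcupP; exists j; rewrite ?jK.
  by rewrite !orbT.
move: PU; rewrite cardfsU1 !inE negb_or niJ niK /=.
move: leJ leK PI; set a := #|` P|; set b := #|` Q|; lia.
Qed.

(** Zorn's lemma for reverse inclusion gives a minimal Hall subfamily, with members of at most one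
    element. Hall's condition on one index makes them nonempty, and on two indices makes them
    distinct. *)
Lemma hall_marriage (I T : choiceType) (A : I -> {fset T}) : hall A ->
  exists phi : I -> T, injective phi /\ forall i, phi i \in A i.
Proof.
move=> hA; pose R (s t : {B | hall B /\ forall i, (B i `<=` A i)%fset}) :=
  `[< forall i, (sval t i `<=` sval s i)%fset >].
have [|r s t|s t|C totC|[B [hB BA]] minB] := @Zorn _ R.
- by move=> t; apply/asboolP => i; exact: fsubset_refl.
- by move=> /asboolP rs /asboolP st; apply/asboolP => i; exact: fsubset_trans (rs i).
- case: s t => [s hs] [t ht] /asboolP /= st /asboolP /= ts; apply: eq_exist.
  by apply/funext => i; apply/eqP; rewrite eqEfsubset ts st.
- have [[B0 CB0]|/set0P] := pselect (C !=set0); last first.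
    move=> /negP/negPn/eqP ->.
    have hAA : hall A /\ forall i, (A i `<=` A i)%fset by [].
    by exists (exist _ A hAA).
  have [||B1 B2 [b1 Cb1 <-] [b2 Cb2 <-]|M hM MC] :=
    @hall_chain _ _ [set sval b | b in C].
  + by exists (sval B0), B0.
  + by move=> _ [b Cb <-]; case: (svalP b).
  + by have [/asboolP|/asboolP] := totC _ _ Cb1 Cb2; [right|left].
  have MA i : (M i `<=` A i)%fset.
    apply: fsubset_trans (MC (sval B0) _ i) _; first by exists B0.
    by case: (svalP B0).
  by exists (exist _ M (conj hM MA)) => b Cb; apply/asboolP => i; apply: MC; exists b.
have sing := hall_minimal hB.
have {}sing i x y : x \in B i -> y \in B i -> x = y.
  apply: sing => B' hB' B'B j.
  have B'A k : (B' k `<=` A k)%fset by apply: fsubset_trans (BA k).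
  have RB : R (exist _ B (conj hB BA)) (exist _ B' (conj hB' B'A)) by apply/asboolP.
  by case: (minB _ RB) => ->.
have ne i : exists x, x \in B i.
  have := hB [fset i]%fset; rewrite cardfs1 big_seq_fset1 cardfs_gt0 => /fset0Pn[x xB].
  by exists x.
have [phi phiB] := choice ne; exists phi; split; last first.
  by move=> i; apply: (fsubsetP (BA i)).
move=> i j E; apply/eqP/negP => /negP ij.
have := hB [fset i; j]%fset; rewrite cardfs2 ij.
suff /fsubset_leq_card : (\bigcup_(k <- [fset i; j]) B k `<=` [fset phi i])%fset.
  by rewrite cardfs1 => le /leq_trans /(_ le).
apply/fsubsetP => t /bigfcupP[k]; rewrite andbT !inE => /orP[]/eqP -> tB.
  by apply/eqP; apply: sing tB (phiB _).
by rewrite E; apply/eqP; apply: sing tB (phiB _).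
Qed.

(** * Folner sets *)

Section Folner.
Variables (R : realType) (Gam : groupType).
Implicit Types (X F T : {fset Gam}) (A : set Gam).

Definition fsetmul X F : {fset Gam} := [fset (x * f)%g | x in X, f in F]%fset.

Lemma fsetmulP X F g :
  reflect (exists x f, [/\ x \in X, f \in F & g = (x * f)%g]) (g \in fsetmul X F).
Proof.
apply: (iffP (imfset2P _ _ _ _ _)) => /= [[x xX [f fF ->]]|[x [f [xX fF ->]]]].
  by exists x, f.
by exists x => //; exists f.
Qed.

Lemma fsetmulA X F T : fsetmul X (fsetmul F T) = fsetmul (fsetmul X F) T.
Proof.
apply/fsetP => g; apply/fsetmulP/fsetmulP.
  move=> [x [_ [xX /fsetmulP[f [t [fF tT ->]]] ->]]]; exists (x * f)%g, t.
  by rewrite mulgA; split=> //; apply/fsetmulP; exists x, f.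
move=> [_ [t [/fsetmulP[x [f [xX fF ->]]] tT ->]]]; exists x, (f * t)%g.
by rewrite mulgA; split=> //; apply/fsetmulP; exists f, t.
Qed.

Lemma fset1mul F : fsetmul [fset 1%g]%fset F = F.
Proof.
apply/fsetP => g; apply/fsetmulP/idP => [[x [f [/[!inE]/eqP-> fF ->]]]|gF].
  by rewrite mul1g.
by exists 1%g, g; rewrite !inE mul1g.
Qed.

(* If every finite set doubles under [T], Hall's theorem gives an injection
   [Gam * bool -> Gam] moving points by left multiplication by elements of [T];
   both halves of its image have full measure. *)
Lemma amenable_not_doubling T :
  amenable Gam R -> ~ forall F, (2 * #|` F| <= #|` fsetmul T F|)%N.
Proof.
move=> [mu [mu0 muT muU muI]] dbl.
pose N (gb : Gam * bool) := fsetmul T [fset gb.1]%fset.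
have hN : hall N.
  move=> J; pose F := [fset gb.1 | gb in J]%fset.
  have JF : (J `<=` [fset (g, true) | g in F] `|` [fset (g, false) | g in F])%fset.
    apply/fsubsetP => -[g b] gJ; have gF : g \in F by apply/imfsetP; exists (g, b).
    by rewrite inE; apply/orP; case: b {gJ}; [left|right]; apply/imfsetP; exists g.
  apply: leq_trans (fsubset_leq_card JF) _; rewrite cardfsU.
  have inj (b : bool) : injective (fun g : Gam => (g, b)) by move=> ? ? [].
  rewrite (card_imfset _ _ (inj true)) (card_imfset _ _ (inj false)) /=.
  apply: leq_trans (leq_subr _ _) _; rewrite addnn -mul2n.
  apply: leq_trans (dbl F) _; apply: fsubset_leq_card; apply/fsubsetP => g.
  move=> /fsetmulP[t [_ [tT /imfsetP[gb /= gbJ ->] ->]]].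
  apply/bigfcupP; exists gb; first by rewrite gbJ.
  by apply/fsetmulP; exists t, gb.1; rewrite inE.
have [phi [phi_inj phiN]] := hall_marriage hN.
(* Sort the group elements by the displacement [t g], which takes finitely many values. On each
   class [phi] is a left multiplication and so preserves [mu]. *)
have piece b : mu ((fun g => phi (g, b)) @` setT) = 1.
  pose t g := (phi (g, b) * g^-1)%g.
  have tT g : t g \in T.
    have /fsetmulP[x [f [xT /[!inE]/eqP/= -> E]]] := phiN (g, b).
    by rewrite /t E mulgK.
  pose D (s : seq Gam) := [set g | t g \in s].
  suff eqD s : mu ((fun g => phi (g, b)) @` (D s)) = mu (D s).
    rewrite -muT -(_ : D T = setT) ?eqD//; apply/seteqP; split=> // g _ /=; exact: tT.
  elim: s => [|x s IH].
    suff -> : D [::] = set0 by rewrite image_set0.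
    by apply/seteqP; split=> g //=; rewrite /D /= in_nil.
  case: (boolP (x \in s)) => xs.
    suff -> : D (x :: s) = D s by [].
    apply/seteqP; split=> g; rewrite /D /= inE; first by move=> /predU1P[->|].
    by move=> gs; apply/predU1P; right.
  pose Dx := [set g | t g = x].
  have DE : D (x :: s) = Dx `|` D s.
    apply/seteqP; split=> g; rewrite /D /Dx /= inE; first by move=> /predU1P.
    by move=> /predU1P.
  have dis : Dx `&` D s = set0.
    by apply/seteqP; split=> // g []; rewrite /Dx /D /= => ->; rewrite (negPf xs).
  rewrite DE image_setU muU ?muU// ?IH; last first.
    apply/seteqP; split=> // h [[g1 g1x <-] [g2 g2s /phi_inj[E]]].
    suff : (Dx `&` D s) g1 by rewrite dis.
    by split=> //; rewrite -E.
  congr (_ + _); rewrite -[RHS](muI x); congr mu; apply/seteqP; split.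
    by move=> _ [g gx <-]; exists g => //; rewrite -gx /t mulgVK.
  by move=> _ [g gx <-]; exists g => //; rewrite -gx /t mulgVK.
(* Two disjoint images of measure 1 would leave measure -1 for their complement. *)
have := mu0 (~` ((fun g => phi (g, true)) @` setT `|` (fun g => phi (g, false)) @` setT)).
have : mu ((fun g => phi (g, true)) @` setT `|` (fun g => phi (g, false)) @` setT) = 2.
  rewrite muU ?piece ?[RHS]natrS//.
  by apply/seteqP; split=> // h [[g1 _ <-] [g2 _ /phi_inj[]]].
set A := _ `|` _ => muA; have := muU A (~` A); rewrite setICr setUCr muT muA.
by move=> /(_ erefl); lra.
Qed.

(** Otherwise every finite set grows by the factor [1 + eps] under [T], hence doubles under a high
    enough power of [T]. *)
Lemma amenable_folner T (eps : R) : amenable Gam R -> 1%g \in T -> 0 < eps ->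
  exists2 F, (0 < #|` F|)%N & #|` fsetmul T F|%:R <= (1 + eps) * #|` F|%:R.
Proof.
move=> am T1 eps0; apply: contrapT => noF.
have exp F : (1 + eps) * #|` F|%:R <= #|` fsetmul T F|%:R.
  have [->|/fset0Pn[f fF]] := eqVneq F fset0; first by rewrite cardfs0 mulr0.
  rewrite leNgt; apply/negP => /ltW lt; apply: noF; exists F => //.
  by rewrite cardfs_gt0; apply/fset0Pn; exists f.
pose Tk k := iter k (fsetmul T) [fset 1%g]%fset.
have expk k F : (1 + eps) ^+ k * #|` F|%:R <= #|` fsetmul (Tk k) F|%:R.
  elim: k F => [|k IH] F; first by rewrite fset1mul mul1r.
  rewrite /Tk iterS -fsetmulA; apply: le_trans (exp _).
  by rewrite exprS -mulrA ler_pM2l ?IH// addr_gt0.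
(* Bernoulli's inequality with more than [1 / eps] factors. *)
have [k le2] : exists k, 2 <= (1 + eps) ^+ k.
  exists (Num.truncn (eps^-1)).+1.
  have bern m : 1 + m%:R * eps <= (1 + eps) ^+ m.
    elim: m => [|m IH]; first by rewrite mul0r addr0.
    rewrite exprS; apply: le_trans (_ : (1 + eps) * (1 + m%:R * eps) <= _).
      have h : 0 <= m%:R * eps * eps by rewrite !mulr_ge0// ltW.
      by rewrite -natr1; lra.
    by rewrite ler_pM2l// addr_gt0.
  apply: le_trans (bern _); rewrite -[2]/(1 + 1) lerD2l.
  have := truncnS_gt (eps^-1); rewrite -(ltr_pM2r eps0) mulVf ?gt_eqF//.
  exact: ltW.
apply: (amenable_not_doubling am (T := Tk k)) => F.
rewrite -(ler_nat R) natrM; apply: le_trans (expk k F).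
by rewrite ler_wpM2r.
Qed.

(* The inverse turns a left Folner set into a right one. *)
Lemma amenable_right_folner (S : {fset Gam}) (eps : R) :
  amenable Gam R -> 0 < eps ->
  exists2 F, (0 < #|` F|)%N & forall s, s \in S ->
    #|` [fset f in F | (f * s)%g \notin F]%fset|%:R <= eps * #|` F|%:R /\
    #|` [fset f in F | (f * s^-1)%g \notin F]%fset|%:R <= eps * #|` F|%:R.
Proof.
move=> am eps0.
pose T := (1%g |` (S `|` [fset s^-1%g | s in S]))%fset.
have T1 : 1%g \in T by rewrite !inE eqxx.
have [F F0 FT] := amenable_folner am T1 eps0.
have invF f : (f \in [fset f^-1%g | f in F]%fset) = (f^-1%g \in F).
  apply/imfsetP/idP => [[g gF ->]|fF]; first by rewrite invgK.
  by exists f^-1%g; rewrite ?invgK.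
have cardV : #|` [fset f^-1%g | f in F]%fset| = #|` F|.
  by rewrite card_imfset//; exact: invg_inj.
exists [fset f^-1%g | f in F]%fset; first by rewrite cardV.
have key t : t^-1%g \in T ->
    #|` [fset f in [fset f^-1%g | f in F] | (f * t)%g \notin [fset f^-1%g | f in F]]%fset|%:R
      <= eps * #|` [fset f^-1%g | f in F]%fset|%:R.
  move=> tT; rewrite cardV.
  have FTF : (F `<=` fsetmul T F)%fset.
    by apply/fsubsetP => f fF; apply/fsetmulP; exists 1%g, f; rewrite mul1g.
  apply: le_trans (_ : (#|` fsetmul T F|%:R - #|` F|%:R : R) <= _); last by lra.
  rewrite -natrB ?fsubset_leq_card// ler_nat -[X in (_ <= X - _)%N](cardfsID F).
  have -> : #|` (fsetmul T F `&` F)%fset| = #|` F| by move/fsetIidPr: FTF => ->.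
  (* Since the inverse of [f t] is [t^-1 f^-1], inversion sends the elements that [t] moves out of
     the inverted set into [fsetmul T F] minus [F]. *)
  have inj : injective (fun f => (f * t)^-1%g) by move=> f g /invg_inj/mulIg.
  rewrite addKn; set X := [fset _ in _ | _]%fset.
  have <- : #|` [fset (f * t)^-1%g | f in X]%fset| = #|` X| by rewrite (card_imfset _ _ inj).
  apply: fsubset_leq_card; apply/fsubsetP => y /imfsetP[f /=].
  rewrite !inE !invF => /andP[fF ftF] ->; rewrite ftF /= invgM.
  by apply/fsetmulP; exists t^-1%g, f^-1%g.
move=> s sS; split; apply: key; rewrite !inE.
  by apply/or3P; apply: Or33; apply/imfsetP; exists s.
by rewrite invgK sS orbT.
Qed.

End Folner.

(** * From almost invariant probabilities on a sofic approximation to means *)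

Lemma ultra_bounded_cvg (R : realType) (T : Type) (U : set_system T) (f : T -> R) (a b : R) :
  UltraFilter U -> (forall t, a <= f t <= b) -> exists l : R, f t @[t --> U] --> l.
Proof.
move=> UU fab; have UP : ProperFilter U := ultra_proper.
have [|l [_ clf]] := @segment_compact _ a b (f t @[t --> U]).
  rewrite /fmap /=; apply: (@filterE _ U) => t /=; rewrite in_itv /=; exact: fab.
exists l => B Bl; have [//|UBC] := in_ultra_setVsetC (f @^-1` B) UU.
have [t [ft Bt]] := clf (~` B) B UBC Bl.
by [].
Qed.

(* The mean is the limit of the almost invariant ones along an ultrafilter. *)
Lemma amenable_almost_invariant (R : realType) (Gam : groupType) (S : {fset Gam}) :
  generates S ->
  (forall eps : R, 0 < eps -> exists mu : set Gam -> R,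
    [/\ forall A, 0 <= mu A, 1 - eps <= mu setT <= 1,
        forall A B, A `&` B = set0 -> mu (A `|` B) = mu A + mu B
      & forall s A, s \in S -> `|mu ((fun a => (s * a)%g) @` A) - mu A| <= eps]) ->
  amenable Gam R.
Proof.
move=> gen approx.
have /choice[mu muP] : forall k : nat, exists mu : set Gam -> R,
    [/\ forall A, 0 <= mu A, 1 - k.+1%:R^-1 <= mu setT <= 1,
        forall A B, A `&` B = set0 -> mu (A `|` B) = mu A + mu B
      & forall s A, s \in S -> `|mu ((fun a => (s * a)%g) @` A) - mu A| <= k.+1%:R^-1].
  by move=> k; apply: approx; rewrite invr_gt0.
have [U [UU ooU]] := ultraFilterLemma (eventually_filter).
have UP : ProperFilter U := ultra_proper.
have /choice[m mP] : forall A, exists l : R, mu k A @[k --> U] --> l.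
  move=> A; apply: (@ultra_bounded_cvg _ _ _ _ 0 1) => k.
  have [mu0 /andP[_ mu1] muU _] := muP k; rewrite mu0 /=.
  apply: le_trans mu1; rewrite -(setUv A) muU ?setICr//.
  by rewrite lerDl.
have lim_uniq (f : nat -> R) (a b : R) : f k @[k --> U] --> a -> f k @[k --> U] --> b -> a = b.
  exact: (@cvg_unique _ (@norm_hausdorff _ _)).
have inv0 : (k.+1%:R^-1 : R) @[k --> U] --> (0 : R).
  by apply: cvg_trans (@cvg_harmonic R); apply: cvg_app.
exists m; split.
- by move=> A; apply: (cvgr_to_ge (mP A)); apply: nearW => k; have [] := muP k.
- apply: (lim_uniq _ _ _ (mP setT)).
  apply: (@squeeze_cvgr _ _ _ _ (fun k => 1 - k.+1%:R^-1) (fun=> 1)).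
  + by apply: nearW => k; have [] := muP k.
  + by rewrite -[X in _ --> X]subr0; apply: cvgB inv0; exact: cvg_cst.
  + exact: cvg_cst.
- move=> A B AB; apply: (lim_uniq _ _ _ (mP (A `|` B))).
  rewrite (_ : (fun k => _) = fun k => mu k A + mu k B); last first.
    by apply/funext => k; have [_ _ -> //] := muP k.
  exact: cvgD (mP A) (mP B).
(* The elements whose translation preserves [m] form a subgroup, so invariance need only be checked
   on generators. *)
pose H : {pred Gam} := [pred g | `[< forall A, m ((fun a => (g * a)%g) @` A) = m A >]].
move=> g A; suff /asboolP : g \in H by apply.
have actA (g1 g2 : Gam) (B : set Gam) :
    (fun a => (g1 * a)%g) @` ((fun a => (g2 * a)%g) @` B) = (fun a => (g1 * g2 * a)%g) @` B.
  by rewrite image_comp; apply: eq_imagel => a _ /=; rewrite mulgA.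
have act1 (B : set Gam) : (fun a => (1 * a)%g) @` B = B.
  by rewrite -[RHS]image_id; apply: eq_imagel => a _ /=; rewrite mul1g.
apply: gen => [|s sS].
  split; first by apply/asboolP => B; rewrite act1.
  move=> g1 g2 /asboolP h1 /asboolP h2; apply/asboolP => B.
  by rewrite -actA h1 -h2 actA mulgV act1.
apply/asboolP => B; apply/eqP; rewrite -subr_eq0; apply/eqP.
apply: (lim_uniq (fun k => mu k ((fun a => (s * a)%g) @` B) - mu k B)).
  exact: cvgB (mP _) (mP _).
apply: (@squeeze_cvgr _ _ _ _ (fun k => - k.+1%:R^-1) (fun k => k.+1%:R^-1)) => //.
  by apply: nearW => k; have [_ _ _ /(_ s B sS)] := muP k; rewrite ler_norml.
by rewrite -oppr0; exact: cvgN.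
Qed.

(** The injection [t] matches the sum of [b] over [Q] with that of [a] over the image of [Q]. The
    two remaining sums both lie between 0 and [#|~: Q|], so they differ by no more than that. *)
Lemma sum_shift_bound (R : realType) (V : finType) (Q : {set V}) (t : V -> V)
    (a b d : V -> R) :
  {in Q &, injective t} ->
  (forall x, 0 <= a x <= 1) -> (forall x, 0 <= b x <= 1) ->
  (forall x, x \in Q -> `|b x - a (t x)| <= d x) ->
  `|\sum_x b x - \sum_x a x| <= \sum_(x in Q) d x + #|~: Q|%:R.
Proof.
move=> tinj a01 b01 bd.
have bound01 (A : {set V}) (f : V -> R) : (forall x, 0 <= f x <= 1) ->
    0 <= \sum_(x in A) f x <= #|A|%:R.
  move=> f01; rewrite sumr_ge0 /=; last by move=> x _; have /andP[] := f01 x.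
  rewrite -sum1_card natr_sum; apply: ler_sum => x _; by have /andP[] := f01 x.
have split_sum (A : {set V}) (f : V -> R) :
    \sum_x f x = \sum_(x in A) f x + \sum_(x in ~: A) f x.
  rewrite (bigID (mem A)) /=; congr (_ + _); apply: eq_bigl => x; by rewrite inE.
rewrite (split_sum Q b) (split_sum (t @: Q) a) big_imset //=.
have /andP[b0 b1] := bound01 (~: Q) b b01.
have /andP[a0 a1] := bound01 (~: (t @: Q)) a a01.
have cardt : #|~: (t @: Q)| = #|~: Q| by rewrite cardsCs finset.setCK [RHS]cardsCs finset.setCK card_in_imset.
rewrite cardt in a1.
have le1 : `|\sum_(x in Q) b x - \sum_(x in Q) a (t x)| <= \sum_(x in Q) d x.
  rewrite -sumrB; apply: le_trans (ler_norm_sum _ _ _) _; exact: ler_sum.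
move: le1; rewrite !ler_norml => /andP[le1 le2]; apply/andP; split; lra.
Qed.

Section AlmostA.
Variables (R : realType) (L : finType) (G : graph_seq L).

(** A common weakening of property A and hyperfiniteness that still produces means: variation is
    controlled only off a set of edges which is sparse for large [n]. *)
Definition almost_propertyA : Prop :=
  forall eps : R, 0 < eps ->
  exists S0 (xi : forall n, vtx G n -> vtx G n -> R)
    (E : forall n, {set vtx G n * L * vtx G n}),
    [/\ forall n x z, 0 <= xi n x z, forall n x, \sum_z xi n x z = 1,
        forall n x z, xi n x z != 0 -> graph_ball (@labelled_edge _ G n) x S0 z,
        forall n s x y, labelled_edge s x y -> (x, s, y) \notin E n ->
          \sum_z `|xi n x z - xi n y z| <= eps
      & \forall n \near \oo, #|E n|%:R <= eps * #|vtx G n|%:R].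

End AlmostA.

(** * Transport of probabilities from one finite graph to the group *)

Section Transport.
Variables (R : realType) (Gam : groupType) (S : {fset Gam}).
Variables (V : finType) (G : S -> rel V) (S0 : nat) (xi : V -> V -> R).
Variables (E : {set V * S * V}) (eps : R).
Hypothesis xi_ge0 : forall x z, 0 <= xi x z.
Hypothesis xi_sum : forall x, \sum_z xi x z = 1.
Hypothesis xi_ball : forall x z, xi x z != 0 -> graph_ball G x S0 z.
Hypothesis xi_edge : forall s x y, G s x y -> (x, s, y) \notin E ->
  \sum_z `|xi x z - xi y z| <= eps.
Hypothesis eps_ge0 : 0 <= eps.
Hypothesis V_gt0 : (0 < #|V|)%N.
Hypothesis E_small : #|E|%:R <= eps * #|V|%:R.

(** The radius leaves room for a support word of length [S0] preceded by a letter and its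
    inverse. *)
Let good : {set V} := finset (fun x => `[< iso_balls G (@cayley _ S) S0.+2 x 1%g >]).
Hypothesis bad_small : #|~: good|%:R <= eps * #|V|%:R.

(* [x^-1 z \in A], for [z] close to a vertex [x] near which [G] looks like the
   Cayley graph *)
Let inA (A : set Gam) (x z : V) : bool :=
  `[< exists w, [/\ (size w <= S0.+1)%N, walk G x w = z & A (eval w)] >].

(** The image of [xi x] under [z |-> x^-1 z], evaluated on [A]. Bad vertices contribute zero, which
    lowers the average by at most [eps]. *)
Let mass A x : R := if x \in good then \sum_z xi x z * (inA A x z)%:R else 0.

Let mu A : R := (\sum_x mass A x) / #|V|%:R.

Let goodP x : reflect (iso_balls G (@cayley _ S) S0.+2 x 1%g) (x \in good).
Proof. by rewrite inE; exact: asboolP. Qed.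

Let inA_walk A x w : x \in good -> (size w <= S0.+1)%N ->
  inA A x (walk G x w) = `[< A (eval w) >].
Proof.
move=> /goodP gx sw; apply/asboolP/asboolP => [[w' [sw' E' Aw']]|Aw]; last by exists w.
by rewrite -((walk_eq gx _ _).1 E')// ltnW.
Qed.

Let supp_walk x z : x \in good -> xi x z != 0 ->
  exists2 w, (size w <= S0)%N & walk G x w = z.
Proof. by move=> /goodP gx /xi_ball; apply: (ball_walk gx); rewrite !leqW. Qed.

Let weighted_01 (c : V -> bool) x : 0 <= \sum_z xi x z * (c z)%:R <= 1.
Proof.
apply/andP; split; first by apply: sumr_ge0 => z _; rewrite mulr_ge0.
by rewrite -[leRHS](xi_sum x); apply: ler_sum => z _; case: (c z); rewrite ?mulr1 ?mulr0.
Qed.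

Let mass_01 A x : 0 <= mass A x <= 1.
Proof. by rewrite /mass; case: ifP => _; rewrite ?weighted_01 ?lexx ?ler01. Qed.

Let V0 : 0 < #|V|%:R :> R. Proof. by rewrite ltr0n. Qed.

Let mu_ge0 A : 0 <= mu A.
Proof.
apply: divr_ge0; last exact: ltW.
by apply: sumr_ge0 => x _; have /andP[] := mass_01 A x.
Qed.

Let mu_setT : 1 - eps <= mu setT <= 1.
Proof.
have massT x : mass setT x = (x \in good)%:R.
  rewrite /mass; case: ifP => // gx; rewrite -[RHS](xi_sum x).
  apply: eq_bigr => z _; have [->|nz] := eqVneq (xi x z) 0; first by rewrite mul0r.
  have [w sw wz] := supp_walk gx nz.
  by rewrite -wz inA_walk ?(leqW sw)// asboolT ?mulr1.
have sumT : \sum_x mass setT x = #|good|%:R.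
  rewrite (eq_bigr _ (fun x _ => massT x)) -sum1_card natr_sum [RHS]big_mkcond /=.
  by apply: eq_bigr => x _; case: ifP.
have := cardsC good => /(congr1 (fun k => k%:R : R)); rewrite natrD => cE.
have b0 : 0 <= #|~: good|%:R :> R by [].
rewrite /mu sumT ler_pdivlMr// ler_pdivrMr//; move: bad_small V0; rewrite -cE => *.
by apply/andP; split; nra.
Qed.

Let mu_additive A B : A `&` B = set0 -> mu (A `|` B) = mu A + mu B.
Proof.
move=> AB; rewrite /mu -mulrDl -big_split; congr (_ / _); apply: eq_bigr => x _ /=.
rewrite /mass; case: ifP => gx; rewrite ?addr0// -big_split; apply: eq_bigr => z _ /=.
have [->|nz] := eqVneq (xi x z) 0; first by rewrite !mul0r addr0.
have [w sw wz] := supp_walk gx nz.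
rewrite -mulrDr -wz !inA_walk ?(leqW sw)//; congr (_ * _).
have [Aw|nAw] := pselect (A (eval w)); have [Bw|nBw] := pselect (B (eval w)).
- by have : (A `&` B) (eval w) by []; rewrite AB.
- by rewrite (asboolT Aw) (asboolF nBw) addr0 asboolT//; left.
- by rewrite (asboolT Bw) (asboolF nAw) add0r asboolT//; right.
- by rewrite (asboolF nAw) (asboolF nBw) addr0 asboolF// => -[].
Qed.

(** With [t x] in the role of [x s], the element [x^-1 z] lies in [s A] exactly when [(x s)^-1 z]
    lies in [A]. Of the five [eps], one comes from ordinary edges, two from the edges in [E] and two
    from the vertices outside [Q]. *)
Let mu_shift s A : s \in S -> `|mu ((fun a => (s * a)%g) @` A) - mu A| <= 5 * eps.
Proof.
move=> sS; pose l : S * bool := ([` sS]%fset, true); pose t x := walk G x [:: l].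
pose Q := good :&: (t @^-1: good).
have lvalE : lval l = s by [].
have edge_t x y : x \in good -> G l.1 x y = (y == t x).
  by move=> /goodP gx; have := walk_edge gx l y (isT : (size (nil : seq (S * bool)) < S0.+2)%N).
have tinj : {in good &, injective t}.
  have back x : x \in good -> walk G (t x) [:: linv l] = x.
    by move=> /goodP gx; apply: (walk_winv gx (w := [:: l])).
  by move=> x y /back {2}<- /back {2}<- ->.
(* A vertex outside [Q] is bad, or good with a bad image; injectivity of [t] on good vertices bounds
   the second kind. *)
have badQ : #|~: Q|%:R <= 2 * eps * #|V|%:R.
  suff le : (#|~: Q| <= #|~: good| + #|~: good|)%N.
    apply: le_trans (_ : (#|~: good| + #|~: good|)%:R <= _); first by rewrite ler_nat.
    by move: bad_small; rewrite natrD; lra.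
  have -> : ~: Q = ~: good :|: (good :&: (t @^-1: ~: good)).
    by apply/setP => x; rewrite !inE; case: `[< _ >].
  apply: leq_trans (leq_card_setU _ _) _; rewrite leq_add2l.
  rewrite -(@card_in_imset _ _ t); last first.
    by move=> x y /setIP[gx _] /setIP[gy _]; exact: tinj.
  apply: subset_leq_card; apply/fintype.subsetP => _ /imsetP[x /setIP[_]] /[!inE] h ->.
  exact: h.
(* On an exceptional edge only the trivial bound 2 on the distance between two probabilities is
   available. *)
pose bd x : R := eps + 2 * ((x, l.1, t x) \in E)%:R.
have pair x : x \in Q -> `|mass ((fun a => (s * a)%g) @` A) x - mass A (t x)| <= bd x.
  rewrite !inE => /andP[/asboolP gx /asboolP gtx].
  have {}gx : x \in good by apply/goodP.
  have {}gtx : t x \in good by apply/goodP.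
  rewrite /mass gx gtx.
  have -> : \sum_z xi x z * (inA ((fun a => (s * a)%g) @` A) x z)%:R =
            \sum_z xi x z * (inA A (t x) z)%:R.
    apply: eq_bigr => z _; have [->|nz] := eqVneq (xi x z) 0; first by rewrite !mul0r.
    have [w sw wz] := supp_walk gx nz; congr (_ * _%:R).
    have wz' : walk G (t x) (linv l :: w) = z.
      rewrite -wz -walk_cat; move/goodP: gx => gx; apply/(walk_eq gx); [exact: sw|by rewrite !leqW|].
      by rewrite /eval /= !big_cons lval_linv mulVKg.
    rewrite -[in LHS]wz inA_walk ?leqW// -wz' inA_walk//.
    have -> : eval (linv l :: w) = (s^-1 * eval w)%g.
      by rewrite -cat1s eval_cat /eval big_seq1 lval_linv.
    congr (nat_of_bool _); apply/asboolP/asboolP => [[a Aa <-]|Aw].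
      by rewrite mulKg.
    by exists (s^-1 * eval w)%g; rewrite ?mulVKg.
  rewrite -sumrB; apply: le_trans (ler_norm_sum _ _ _) _.
  apply: le_trans (_ : \sum_z `|xi x z - xi (t x) z| <= _).
    apply: ler_sum => z _; rewrite -mulrBl normrM ler_piMr//.
    by case: inA; rewrite ?normr1 ?normr0.
  rewrite /bd; case: (boolP (_ \in E)) => eE; rewrite ?mulr1 ?mulr0 ?addr0; last first.
    by apply: xi_edge eE; rewrite edge_t.
  apply: le_trans (_ : \sum_z (xi x z + xi (t x) z) <= _).
    by apply: ler_sum => z _; apply: le_trans (ler_normB _ _) _; rewrite !ger0_norm.
  by rewrite big_split /= !xi_sum; move: eps_ge0; lra.
have tQ : {in Q &, injective t} by move=> x y /setIP[gx _] /setIP[gy _]; exact: tinj.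
have := sum_shift_bound tQ (mass_01 A) (mass_01 ((fun a => (s * a)%g) @` A)) pair.
have sbd : \sum_(x in Q) bd x <= 3 * eps * #|V|%:R.
  rewrite big_split /= -mulr_sumr.
  have h1 : \sum_(x in Q) eps <= eps * #|V|%:R.
    by rewrite sumr_const -[eps *+ _]mulr_natr ler_wpM2l// ler_nat max_card.
  have h2 : \sum_(x in Q) ((x, l.1, t x) \in E)%:R <= #|E|%:R :> R.
    rewrite -natr_sum ler_nat -big_mkcondr /= sum1_card.
    rewrite -(@card_imset _ _ (fun x => (x, l.1, t x))); last by move=> x y [].
    apply: subset_leq_card; apply/fintype.subsetP => _ /imsetP[x /andP[_ xE] ->]; exact: xE.
  by move: h1 h2 E_small; lra.
have Vi : 0 <= (#|V|%:R : R)^-1 by rewrite invr_ge0 ltW.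
rewrite /mu -mulrBl normrM (ger0_norm Vi) ler_pdivrMr//.
by move: badQ sbd; lra.
Qed.

Lemma transport_mean : exists mu : set Gam -> R,
  [/\ forall A, 0 <= mu A, 1 - eps <= mu setT <= 1,
      forall A B, A `&` B = set0 -> mu (A `|` B) = mu A + mu B
    & forall s A, s \in S -> `|mu ((fun a => (s * a)%g) @` A) - mu A| <= 5 * eps].
Proof. by exists mu; split. Qed.

End Transport.

Lemma sofic_bad_small (R : realType) (Gam : groupType) (S : {fset Gam}) (G : graph_seq S)
    (r : nat) (eps : R) : sofic_approximation R G -> 0 < eps ->
  \forall n \near \oo, #|~: finset (fun x =>
     `[< iso_balls (@labelled_edge _ G n) (@cayley _ S) r x 1%g >])|%:R
     <= eps * #|vtx G n|%:R.
Proof.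
move=> sof eps0; have /cvgrPdist_le/(_ _ eps0) := sof r.
apply: filterS => n; have [V0 _] := graph_seq_connected G n.
rewrite cardsCs finset.setCK cardsE natrB ?max_card// -(@ler_pM2r _ #|vtx G n|%:R) ?ltr0n//.
set c := #|_|; have cle : (c <= #|vtx G n|)%N by exact: max_card.
rewrite -[X in _ * X <= _]ger0_norm// -normrM mulrBl mul1r divfK ?pnatr_eq0 -?lt0n//.
exact: le_trans (ler_norm _).
Qed.

Lemma almost_propertyA_amenable (R : realType) (Gam : groupType) (S : {fset Gam})
    (G : graph_seq S) :
  generates S -> sofic_approximation R G -> almost_propertyA R G -> amenable Gam R.
Proof.
move=> gen sof AG; apply: (amenable_almost_invariant gen) => eps eps0.
have e0 : 0 < eps / 5 by rewrite divr_gt0.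
have [S0 [xi [E [xi0 xi1 xiB xiE Es]]]] := AG _ e0.
have [n [En badn]] := @filter_ex _ _ _ _ (filterI Es (sofic_bad_small S0.+2 sof e0)).
have [V0 _] := graph_seq_connected G n.
have [mu [mu0 muT muU muI]] :=
  transport_mean (xi0 n) (xi1 n) (xiB n) (xiE n) (ltW e0) V0 En badn.
exists mu; split=> // [|s A sS]; first by move: muT; lra.
by apply: le_trans (muI _ _ sS) _; lra.
Qed.

Lemma in_vtx_inj (L : finType) (G : graph_seq L) n : injective (@in_vtx L G n).
Proof. by move=> x y /eqP; rewrite eq_Tagged => /eqP. Qed.

Lemma esum_in_vtx (R : realType) (L : finType) (G : graph_seq L) n (F : all_vtx G -> R) :
  (forall z, 0 <= F z) ->
  (forall z, F z != 0 -> exists y : vtx G n, z = in_vtx y) ->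
  (\esum_(z in [set: all_vtx G]) (F z)%:E = (\sum_(y : vtx G n) F (in_vtx y))%:E)%E.
Proof.
move=> F0 Fn; have -> : (\esum_(z in [set: all_vtx G]) (F z)%:E =
    \esum_(z in range (@in_vtx L G n)) (F z)%:E)%E.
  rewrite [RHS]esum_mkcond; apply: eq_esum => z _; case: ifPn => // /negP nz.
  have [->//|/Fn[y zy]] := eqVneq (F z) 0.
  by case: nz; apply/mem_set; exists y.
rewrite esum_image; last by move=> x y _ _; exact: in_vtx_inj.
rewrite esum_fset; [|exact: finite_finset|by move=> i _; rewrite lee_fin].
have fin : finite_set [set: vtx G n] by exact: finite_finset.
rewrite fsbig_finite// -sumEFin; apply: perm_big; apply: uniq_perm.
- exact: fset_uniq.
- exact: index_enum_uniq.
- by move=> y; rewrite (in_fset_set fin) mem_index_enum; apply/mem_set.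
Qed.

(** Absolute values turn the signed functions into probabilities with the same supports; the reverse
    triangle inequality controls their variation along edges. *)
Lemma propertyA_vertexwise (R : realType) (L : finType) (G : graph_seq L) (eps : R) :
  propertyA R G -> 0 < eps ->
  exists S0 (xi : forall n, vtx G n -> vtx G n -> R),
    [/\ forall n x z, 0 <= xi n x z, forall n x, \sum_z xi n x z = 1,
        forall n x z, xi n x z != 0 -> graph_ball (@labelled_edge _ G n) x S0 z
      & forall n s (x y : vtx G n), labelled_edge s x y ->
          \sum_z `|xi n x z - xi n y z| <= eps].
Proof.
move=> pA eps0; have [S0 [_ [xi [xi1 xiB xiE]]]] := pA _ eps0.
have supp n (x : vtx G n) z : xi (in_vtx x) z != 0 -> exists y : vtx G n, z = in_vtx y.
  by move=> /xiB[y _ ->]; exists y.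
exists S0, (fun n x z => `|xi (in_vtx x) (in_vtx z)|); split.
- by [].
- move=> n x; apply: EFin_inj; rewrite -[RHS](xi1 (in_vtx x)).
  rewrite (@esum_in_vtx _ _ _ n (fun z => `|xi (in_vtx x) z|))// => z.
  by rewrite normr_eq0; exact: supp.
- by move=> n x z; rewrite normr_eq0 => /xiB[y yB /in_vtx_inj ->].
- move=> n s x y /xiE; rewrite (@esum_in_vtx _ _ _ n (fun z => `|xi (in_vtx x) z - xi (in_vtx y) z|))//.
    rewrite lte_fin => /ltW; apply: le_trans; apply: ler_sum => z _.
    exact: ler_dist_dist.
  move=> z; rewrite normr_eq0 subr_eq0.
  have [->|/supp[t ->] _] := eqVneq (xi (in_vtx x) z) 0; last by exists t.
  by rewrite eq_sym; exact: supp.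
Qed.

Lemma propertyA_almost (R : realType) (L : finType) (G : graph_seq L) :
  propertyA R G -> almost_propertyA R G.
Proof.
move=> pA eps eps0; have [S0 [xi [xi0 xi1 xiB xiE]]] := propertyA_vertexwise pA eps0.
exists S0, xi, (fun=> finset.set0); split=> //; first by move=> n s x y /xiE.
by apply: nearW => n; rewrite cards0 mulr_ge0// ltW.
Qed.

(** A path without repetitions stays in the component, whose size therefore bounds its length. This
    places the component in a ball of radius [K]. *)
Lemma connect_card_path (T : finType) (e : rel T) x y K :
  (#|connect e x| <= K)%N -> connect e x y ->
  exists p, [/\ path e x p, last x p = y & (size p <= K)%N].
Proof.
move=> cK /connectP[p pp ->]; case/shortenP: pp => p' pp' up' _.
exists p'; split=> //; apply: leq_trans cK.
apply: leq_trans (_ : size (x :: p') <= _)%N; first exact: leqnSn.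
rewrite -(card_uniqP up'); apply: subset_leq_card; apply/fintype.subsetP => z.
by rewrite inE => /(path_connect pp').
Qed.

(* [xi_x] is the uniform probability on the component of [x]. *)
Lemma hyperfinite_almost (R : realType) (L : finType) (G : graph_seq L) :
  hyperfinite R G -> almost_propertyA R G.
Proof.
move=> hG eps eps0; have [K [_ [E [_ [l leps El] EK]]]] := hG _ eps0.
pose e n := linked (remove_edges (@labelled_edge _ G n) (E n)).
have esym n : connect_sym (e n) by apply: sym_connect_sym; exact: linked_sym.
have c0 n x : 0 < #|connect (e n) x|%:R :> R.
  by rewrite ltr0n; apply/card_gt0P; exists x; exact: connect0.
exists K, (fun n x z => (connect (e n) x z)%:R / #|connect (e n) x|%:R), E; split.
- by move=> n x z; rewrite divr_ge0// ltW.
- move=> n x; rewrite -mulr_suml -natr_sum -big_mkcond sum1_card divff//.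
  by apply: lt0r_neq0; exact: c0.
- move=> n x z; case: (boolP (connect (e n) x z)) => [xz _|_]; last by rewrite mul0r eqxx.
  have [p [pp lp sp]] := connect_card_path (EK n x) xz.
  exists p; split=> //; apply: sub_path pp => u v /existsP[s uv]; apply/existsP; exists s.
  by move: uv; rewrite /remove_edges => /orP[]/andP[-> _]; rewrite ?orbT.
- move=> n s x y xy nE; rewrite big1 ?ltW// => z _.
  have exy : connect (e n) x y.
    by apply: connect1; apply/existsP; exists s; rewrite /remove_edges xy nE.
  have E1 : connect (e n) x =1 connect (e n) y by exact: same_connect (esym n) _ _ exy.
  by rewrite (eq_card E1) E1 subrr normr0.
- have : \forall n \near \oo, #|E n|%:R / #|vtx G n|%:R <= eps by apply: cvgr_le El _ leps.
  apply: filterS => n; have [V0 _] := graph_seq_connected G n.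
  by rewrite ler_pdivrMr ?ltr0n.
Qed.

(** * Hyperfiniteness of sofic approximations of amenable groups *)

Section Greedy.
Variables (R : realType) (L V : finType) (G : L -> rel V).
Implicit Types (A U : {set V}) (E : {set V * L * V}).

Definition boundary A : {set V * L * V} :=
  finset (fun e => (e \in edges G) && ((e.1.1 \in A) != (e.2 \in A))).

Local Notation cut E := (linked (remove_edges G E)).

Lemma connect_sub_closed (e : rel V) A x :
  x \in A -> (forall u v, u \in A -> e u v -> v \in A) -> {subset connect e x <= A}.
Proof.
move=> xA clA _ /connectP[p pp ->]; elim: p x xA pp => //= y p IH x xA /andP[xy].
by apply: IH; exact: clA xy.
Qed.

Lemma cutP E x y : cut E x y -> exists s,
  (G s x y /\ (x, s, y) \notin E) \/ (G s y x /\ (y, s, x) \notin E).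
Proof. by move=> /existsP[s /orP[]/andP[]]; exists s; [left|right]. Qed.

Lemma cut_sub E E' x y : E \subset E' -> cut E' x y -> cut E x y.
Proof.
move=> /fintype.subsetP EE' /cutP[s [[g nE]|[g nE]]]; apply/existsP; exists s.
  by rewrite /remove_edges g (contra (EE' _) nE).
by rewrite /remove_edges g (contra (EE' _) nE) ?orbT.
Qed.

Lemma card_edges_incident A D : (forall x, (degree G x <= D)%N) ->
  (#|finset (fun e : V * L * V => (e \in edges G) && ((e.1.1 \in A) || (e.2 \in A)))|
     <= D * #|A|)%N.
Proof.
move=> degD.
have outE : #|finset (fun e : V * L * V => (e \in edges G) && (e.1.1 \in A))| =
    (\sum_(x in A) \sum_s #|[pred y | G s x y]|)%N.
  rewrite -sum1_card big_mkcond [RHS]big_mkcond /=.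
  under [RHS]eq_bigr => x _.
    rewrite (_ : (if _ then _ else _) = \sum_s \sum_y (G s x y && (x \in A)))%N; last first.
      case: ifP => xA; last by rewrite big1// => s _; rewrite big1// => y _; rewrite andbF.
      by apply: eq_bigr => s _; rewrite -sum1_card big_mkcond;
         apply: eq_bigr => y _; rewrite andbT inE; case: ifP.
    over.
  rewrite !pair_bigA /=; apply: eq_bigr => -[[x s] y] _ /=; rewrite !inE /=.
  by case: ifP.
have inE' : #|finset (fun e : V * L * V => (e \in edges G) && (e.2 \in A))| =
    (\sum_(x in A) \sum_s #|[pred y | G s y x]|)%N.
  rewrite -sum1_card big_mkcond [RHS]big_mkcond /=.
  under [RHS]eq_bigr => x _.
    rewrite (_ : (if _ then _ else _) = \sum_s \sum_y (G s y x && (x \in A)))%N; last first.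
      case: ifP => xA; last by rewrite big1// => s _; rewrite big1// => y _; rewrite andbF.
      by apply: eq_bigr => s _; rewrite -sum1_card big_mkcond;
         apply: eq_bigr => y _; rewrite andbT inE; case: ifP.
    over.
  rewrite exchange_big; under [RHS]eq_bigr do rewrite exchange_big.
  rewrite exchange_big /= !pair_bigA /=; apply: eq_bigr => -[[x s] y] _ /=; rewrite !inE /=.
  by case: ifP.
apply: leq_trans (_ : \sum_(x in A) degree G x <= _)%N; last first.
  by rewrite mulnC -sum_nat_const; apply: leq_sum.
under eq_bigr do rewrite /degree big_split /=.
rewrite big_split /= -outE -inE'; apply: leq_trans (leq_card_setU _ _).
apply: subset_leq_card; apply/fintype.subsetP => e.
by rewrite !inE => /andP[-> /orP[->|->]]; rewrite ?orbT.
Qed.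

(* As long as many vertices are left, cut out of the remaining set [U] the piece
   [A :&: U], paying for the boundary of [A] in proportion to [#|A :&: U|]. *)
Lemma greedy_partition (c dl : R) (K D : nat) :
  0 <= c -> (forall x, (degree G x <= D)%N) ->
  (forall U, dl * #|V|%:R < #|U|%:R -> exists A,
     [/\ (#|A| <= K)%N, (0 < #|A :&: U|)%N & #|boundary A|%:R <= c * #|A :&: U|%:R]) ->
  0 <= dl ->
  exists E, [/\ E \subset edges G, #|E|%:R <= (c + D%:R * dl) * #|V|%:R
    & forall x, (#|connect (cut E) x| <= maxn K 1)%N].
Proof.
move=> c0 degD tile dl0.
(* [U] is what remains. Removed edges are charged at rate [c] to the vertices already carved out,
   and no surviving edge joins those vertices to [U]. *)
pose inv U E := [/\ E \subset edges G, #|E|%:R + c * #|U|%:R <= c * #|V|%:R,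
  forall x, x \notin U -> (#|connect (cut E) x| <= K)%N
  & forall x y, x \notin U -> cut E x y -> y \notin U].
have [U [E [invUE smallU]]] : exists U E, inv U E /\ #|U|%:R <= dl * #|V|%:R.
  suff claim m : forall U E, (#|U| <= m)%N -> inv U E ->
      exists U E, inv U E /\ #|U|%:R <= dl * #|V|%:R.
    apply: (claim #|V| [set: V]%SET finset.set0); first exact: max_card.
    split; rewrite ?finset.sub0set ?cards0 ?add0r ?cardsT//; by move=> x; rewrite inE.
  elim: m => [|m IH] U E Um iUE.
    by exists U, E; split=> //; move: Um; rewrite leqn0 => /eqP->; rewrite mulr_ge0.
  have [sU|bigU] := leP (#|U|%:R : R) (dl * #|V|%:R); first by exists U, E.
  have [A [AK AU bA]] := tile U bigU; have [EG Ec EK Ecut] := iUE.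
  have cardU : #|U| = (#|A :&: U| + #|U :\: A|)%N by rewrite finset.setIC cardsID.
  apply: (IH (U :\: A) (E :|: boundary A)); first by move: Um AU; rewrite cardU; lia.
  have subE : E \subset E :|: boundary A by exact: finset.subsetUl.
  have cutA x y : x \in A -> cut (E :|: boundary A) x y -> y \in A.
    move=> xA /cutP[s [[g]|[g]]]; rewrite !inE g xA negb_or => /andP[_] /=.
      by rewrite negbK.
    by rewrite negbK => /eqP.
  have newcut x y : x \notin U :\: A -> cut (E :|: boundary A) x y -> y \notin U :\: A.
    rewrite !inE; case: (boolP (x \in A)) => [xA _ /(cutA _ _ xA) ->//|_ /= xU xy].
    by rewrite negb_and (Ecut _ _ xU (cut_sub subE xy)) orbT.
  split=> //.
  - by rewrite finset.subUset EG; apply/fintype.subsetP => e; rewrite inE => /andP[].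
  - have : (#|E :|: boundary A| <= #|E| + #|boundary A|)%N by exact: leq_card_setU.
    rewrite -(ler_nat R) natrD; move: Ec bA; rewrite cardU natrD; lra.
  - move=> x; rewrite !inE negb_and negbK; case: (boolP (x \in U)) => [xU|xU _].
      rewrite orbF => xA; apply: leq_trans (AK); apply: subset_leq_card.
      by apply/fintype.subsetP; apply: connect_sub_closed xA _ => u v; exact: cutA.
    apply: leq_trans (EK _ xU); apply: subset_leq_card; apply/fintype.subsetP => y.
    by apply: connect_sub => u v uv; apply: connect1; exact: cut_sub uv.
have [EG Ec EK Ecut] := invUE.
(* The few vertices never captured become singletons once every edge touching them is removed; hence
   the term [D%:R * dl] and the bound [maxn K 1]. *)
pose I : {set V * L * V} :=
  finset (fun e : V * L * V => (e \in edges G) && ((e.1.1 \in U) || (e.2 \in U))).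
have cI : #|I|%:R <= D%:R * (dl * #|V|%:R) :> R.
  apply: le_trans (_ : (D * #|U|)%:R <= _); first by rewrite ler_nat card_edges_incident.
  by rewrite natrM ler_wpM2l.
exists (E :|: I); split.
- by rewrite finset.subUset EG; apply/fintype.subsetP => e; rewrite inE => /andP[].
- have : (#|E :|: I| <= #|E| + #|I|)%N by exact: leq_card_setU.
  rewrite -(ler_nat R) natrD; move: Ec cI.
  by have : 0 <= c * #|U|%:R by [rewrite mulr_ge0]; lra.
- move=> x; case: (boolP (x \in U)) => xU; last first.
    rewrite leq_max; apply/orP; left; apply: leq_trans (EK _ xU).
    apply: subset_leq_card; apply/fintype.subsetP => y.
    apply: connect_sub => u v uv; apply: connect1; apply: cut_sub uv; exact: finset.subsetUl.
  rewrite leq_max; apply/orP; right; rewrite -(cards1 x); apply: subset_leq_card.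
  apply/fintype.subsetP; apply: connect_sub_closed; first by rewrite inE.
  move=> u v; rewrite inE => /eqP-> /cutP[s [[g]|[g]]];
    by rewrite !inE g xU ?orbT.
Qed.

End Greedy.

(** * Copies of a finite subset of the group inside the graph *)

Section Tiles.
Variables (Gam : groupType) (S : {fset Gam}) (V : finType) (G : S -> rel V).
Variables (F : {fset Gam}) (wd : Gam -> seq (S * bool)) (m r : nat).
Hypothesis wdK : forall g, eval (wd g) = g.
Hypothesis wd_size : forall g, g \in F -> (size (wd g) <= m)%N.
Hypothesis mr : (m + m < r)%N.

Let good : {set V} := finset (fun x => `[< iso_balls G (@cayley _ S) r x 1%g >]).

(** The translate [x F], traced by one chosen word for each element of [F]; it is a faithful copy of
    [F] when [x] is good. *)
Definition tile x : {set V} := [set walk G x (wd (val f)) | f : F].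

Let wdS (f : F) : (size (wd (val f)) <= m)%N. Proof. exact/wd_size/valP. Qed.

Let tile_inj x : x \in good -> injective (fun f : F => walk G x (wd (val f))).
Proof.
rewrite inE => /asboolP gx f g /(walk_eq gx) E; apply: val_inj.
by rewrite -(wdK (val f)) -(wdK (val g)) E//; apply: leq_trans (wdS _) _; move: mr; lia.
Qed.

Lemma card_tile x : (#|tile x| <= #|` F|)%N.
Proof. by apply: leq_trans (leq_imset_card _ _) _; rewrite cardfE. Qed.

(* The edges leaving the tile come from the pairs [(l, f)] with [f l] outside [F]. *)
Lemma card_boundary_tile x : x \in good ->
  (#|boundary G (tile x)| <=
     \sum_(l : S * bool) #|` [fset f in F | (f * lval l)%g \notin F]%fset|)%N.
Proof.
move=> gx; move: (gx); rewrite inE => /asboolP gx'.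
have mr' : (m < r)%N by move: mr; lia.
pose w f := walk G x (wd f).
pose out : {set (S * bool) * F} :=
  finset (fun lf : (S * bool) * F => (val lf.2 * lval lf.1)%g \notin F).
pose e (lf : (S * bool) * F) : V * S * V :=
  let y := walk G x (rcons (wd (val lf.2)) lf.1) in
  if lf.1.2 then (w (val lf.2), lf.1.1, y) else (y, lf.1.1, w (val lf.2)).
have leave l (f : F) y : letter_edge G l (w (val f)) y -> y \notin tile x ->
    (val f * lval l)%g \notin F /\ y = walk G x (rcons (wd (val f)) l).
  rewrite (walk_edge gx' l); last by apply: leq_ltn_trans (wdS f) _.
  move=> /eqP -> nt; split=> //; apply: contra nt => flF; apply/imsetP.
  exists [` flF]%fset => //=; apply/(walk_eq gx').
  - by rewrite size_rcons; apply: leq_ltn_trans (wdS f) _.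
  - by apply: leq_trans (wd_size flF) _; exact: ltnW.
  - by rewrite eval_rcons !wdK.
have sub : boundary G (tile x) \subset e @: out.
  apply/fintype.subsetP => -[[u s] v]; rewrite !inE /= => /andP[g].
  case: (boolP (u \in tile x)) => [/imsetP[f _ uf] nv|nu /negbNE/imsetP[f _ vf]].
    have [|nF vE] := @leave (s, true) f v _ nv; first by rewrite /letter_edge/= /w -uf.
    by apply/imsetP; exists ((s, true), f); rewrite ?inE//= /e/= -vE uf.
  have [|nF uE] := @leave (s, false) f u _ nu; first by rewrite /letter_edge/= /w -vf.
  by apply/imsetP; exists ((s, false), f); rewrite ?inE//= /e/= -uE vf.
apply: leq_trans (subset_leq_card sub) _; apply: leq_trans (leq_imset_card _ _) _.
rewrite -sum1_card (eq_bigl (fun lf => true && ((val lf.2 * lval lf.1)%g \notin F))); last first.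
  by move=> lf; rewrite inE.
rewrite -(pair_big_dep xpredT (fun l (f : F) => (val f * lval l)%g \notin F) (fun _ _ => 1%N)) /=.
apply: leq_sum => l _; rewrite sum1_card cardE -(size_map val).
apply: uniq_leq_size; first by rewrite map_inj_uniq ?enum_uniq//; exact: val_inj.
move=> y /mapP[f]; rewrite mem_enum => fl ->; rewrite !inE; apply/andP; split; first exact: valP.
exact: fl.
Qed.

(** Count the pairs of a good [x] and an [f] in [F] with [x f] in [U]. For fixed [f] the map
    [x |-> x f] is injective on good vertices, so it misses at most [#|~: good|] points of [U]. *)
Lemma card_tiles_capture (U : {set V}) :
  (#|` F| * #|U| <= \sum_(x in good) #|tile x :&: U| + #|` F| * #|~: good|)%N.
Proof.
have walk_inj (f : F) : {in good &, injective (fun x => walk G x (wd (val f)))}.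
  have back x : x \in good -> walk G (walk G x (wd (val f))) (winv (wd (val f))) = x.
    rewrite inE => /asboolP gx; apply: (walk_winv gx).
    by apply: leq_trans (leq_add (wdS f) (wdS f)) _; move: mr; lia.
  by move=> x y /back {2}<- /back {2}<- ->.
have hit (f : F) : (#|U| <= #|[set x in good | walk G x (wd (val f)) \in U]%SET| + #|~: good|)%N.
  pose T := [set walk G x (wd (val f)) | x in good]%SET.
  have cT : #|~: T| = #|~: good|.
    by rewrite cardsCs finset.setCK [RHS]cardsCs finset.setCK card_in_imset.
  rewrite -cT -(cardsID T U); apply: leq_add; last first.
    by apply: subset_leq_card; apply/fintype.subsetP => y; rewrite !inE => /andP[].
  rewrite -[leqRHS](@card_in_imset _ _ (fun x => walk G x (wd (val f)))); last first.
    by move=> x y /setIdP[xg _] /setIdP[yg _]; exact: walk_inj.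
  apply: subset_leq_card; apply/fintype.subsetP => y; rewrite inE => /andP[yU /imsetP[x xg yE]].
  by apply/imsetP; exists x => //; apply/setIdP; rewrite -yE.
have -> : (\sum_(x in good) #|tile x :&: U| =
    \sum_(f : F) #|[set x in good | walk G x (wd (val f)) \in U]%SET|)%N.
  transitivity (\sum_(x in good) \sum_(f : F) (walk G x (wd (val f)) \in U))%N.
    apply: eq_bigr => x xg.
    rewrite -sum1_card (eq_bigl (fun y => (y \in tile x) && (y \in U))); last by move=> y; rewrite inE.
    rewrite big_mkcondr /= big_imset /=; last by move=> f g _ _; exact: tile_inj.
    by apply: eq_bigr => f _; case: ifP.
  rewrite exchange_big /=; apply: eq_bigr => f _.
  rewrite -sum1_card [RHS](eq_bigl (fun x => (x \in good) && (walk G x (wd (val f)) \in U))).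
    by rewrite [RHS]big_mkcondr /=; apply: eq_bigr => x _; case: (_ \in U).
  by move=> x; rewrite !inE.
have sumF c : (#|` F| * c = \sum_(f : F) c)%N.
  by rewrite cardfE -sum_nat_const; apply: eq_bigl.
rewrite !sumF -big_split /=; apply: leq_sum => f _; exact: hit.
Qed.

End Tiles.

Lemma subset_between (T : finType) (A B : {set T}) k :
  A \subset B -> (#|A| <= k <= #|B|)%N ->
  exists C : {set T}, [/\ A \subset C, C \subset B & #|C| = k].
Proof.
move=> AB /andP[Ak kB]; pose s := take (k - #|A|) (enum (B :\: A)).
have us : uniq s by rewrite take_uniq ?enum_uniq.
have sBA x : x \in s -> x \in B :\: A by move=> /mem_take; rewrite mem_enum.
exists (A :|: [set x in s]%SET); split; first exact: finset.subsetUl.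
  rewrite finset.subUset AB; apply/fintype.subsetP => x; rewrite inE => /sBA.
  by rewrite inE => /andP[].
rewrite cardsU (_ : A :&: [set x in s]%SET = finset.set0); last first.
  by apply/setP => x; rewrite !inE; apply/negP => /andP[xA /sBA]; rewrite inE xA.
rewrite cards0 subn0 cardsE (card_uniqP us) size_take_min -cardE.
have := cardsID A B; rewrite (finset.setIidPr AB); move: Ak kB; lia.
Qed.

(** Each vertex is an endpoint of some edge, and an edge has at most two endpoints. This guarantees
    enough edges for padding the removed sets. *)
Lemma connected_card_edges (L V : finType) (G : L -> rel V) :
  connected_graph G -> (1 < #|V|)%N -> (#|V| <= 2 * #|edges G|)%N.
Proof.
move=> [_ conn] V1.
have sub : [set: V]%SET \subset
    [set e.1.1 | e in edges G]%SET :|: [set e.2 | e in edges G]%SET.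
  apply/fintype.subsetP => x _; have [y yx] : exists y, y != x.
    have : (0 < #|predC1 x|)%N by rewrite cardC1; lia.
    by move=> /card_gt0P[y yx]; exists y.
  have /connectP[[|z p] /= pp yE] := conn x y; first by rewrite yE eqxx in yx.
  move: pp => /andP[/existsP[s /orP[g|g]] _]; rewrite !inE; apply/orP.
    by left; apply/imsetP; exists (x, s, z); rewrite ?inE.
  by right; apply/imsetP; exists (z, s, x); rewrite ?inE.
rewrite -cardsT; apply: leq_trans (subset_leq_card sub) _.
apply: leq_trans (leq_card_setU _ _) _; rewrite mul2n -addnn.
by apply: leq_add; exact: leq_imset_card.
Qed.

Lemma card_connect_no_edges (L V : finType) (G : L -> rel V) (E : {set V * L * V}) x :
  edges G \subset E -> #|connect (linked (remove_edges G E)) x| = 1%N.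
Proof.
move=> /fintype.subsetP GE; rewrite -(cards1 x); apply: eq_card => y; rewrite inE.
apply/idP/eqP => [/connectP[[|z p] //= /andP[/cutP[s [[g]|[g]]]]]|->]; last exact: connect0.
  by rewrite GE// inE.
by rewrite GE// inE.
Qed.

(** * From Folner sets to hyperfiniteness *)

Section AmenableHyperfinite.
Variables (R : realType) (Gam : groupType) (S : {fset Gam}) (G : graph_seq S).
Hypothesis gen : generates S.
Hypothesis sof : sofic_approximation R G.
Hypothesis am : amenable Gam R.

Lemma amenable_partition (e0 : R) : 0 < e0 -> exists K,
  \forall n \near \oo, exists E : {set vtx G n * S * vtx G n}, [/\ E \subset edges (@labelled_edge _ G n),
    #|E|%:R <= e0 * #|vtx G n|%:R
    & forall x, (#|connect (linked (remove_edges (@labelled_edge _ G n) E)) x| <= maxn K 1)%N].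
Proof.
move=> e0_gt0; have [D degD] := graph_seq_degree G.
(* Half of [e0] pays for tile boundaries, the other half for isolating a leftover of proportion
   [dl]. Bad vertices may use up [dl / 2], and [b] is the product of the rate [e0 / 2] with the
   remaining [dl / 2]. *)
pose dl := e0 / (2 * (D%:R + 1)); pose b := e0 * dl / 4.
have D0 : 0 <= D%:R :> R by [].
have dl0 : 0 < dl by rewrite divr_gt0// mulr_gt0// ltr_wpDl.
have b0 : 0 < b by rewrite divr_gt0// mulr_gt0.
pose k := #|{: S * bool}|.
(* The allowance [b] is shared among the [k] signed letters; adding 1 avoids a zero denominator. *)
have e'0 : 0 < b / (k%:R + 1) by rewrite divr_gt0// ltr_wpDl.
have [F F0 FS] := amenable_right_folner S am e'0.
have /choice[wd wdK] := (fun g => generates_word g gen).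
pose m := \max_(f <- F) size (wd f).
have wd_size g : g \in F -> (size (wd g) <= m)%N.
  by move=> gF; rewrite /m (big_rem g)//= leq_maxl.
have badn := sofic_bad_small (m + m).+1 sof (divr_gt0 dl0 (ltr0n R 2)).
exists #|` F|; apply: filterS badn => n badn.
set V := vtx G n in badn *; set good := finset _ in badn.
have [V0 _] := graph_seq_connected G n; rewrite -/V in V0.
have V0' : 0 < #|V|%:R :> R by rewrite ltr0n.
have F0' : 0 < #|` F|%:R :> R by rewrite ltr0n.
have bdF x : x \in good ->
    #|boundary (@labelled_edge _ G n) (tile (@labelled_edge _ G n) F wd x)|%:R <= b * #|` F|%:R.
  move=> xg; have := card_boundary_tile wdK wd_size (leqnn _) xg.
  rewrite -(ler_nat R) => /le_trans; apply.
  rewrite natr_sum; apply: le_trans (_ : \sum_(l : S * bool) b / (k%:R + 1) * #|` F|%:R <= _).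
    apply: ler_sum => -[s []] _; have [? ?] := FS _ (valP s); by rewrite /lval.
  rewrite sumr_const -/k -[_ *+ k]mulr_natr mulrAC ler_pM2r//.
  rewrite -mulrA ler_piMr// ?(ltW b0)// ler_pdivrMl ?ltr_wpDl//; lra.
have [] := @greedy_partition R S V (@labelled_edge _ G n) (e0 / 2) dl #|` F| D.
- by rewrite ltW// divr_gt0.
- by move=> x; exact: degD.
(* If no tile were cheap enough, each would capture so little of [U] that the sum over good vertices
   would contradict the count of captured pairs. *)
- move=> U bigU; apply: contrapT => none.
  have le x : x \in good ->
      e0 / 2 * #|tile (@labelled_edge _ G n) F wd x :&: U|%:R <= b * #|` F|%:R.
    move=> xg; rewrite leNgt; apply/negP => lt; apply: none.
    exists (tile (@labelled_edge _ G n) F wd x); split; first exact: card_tile.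
      rewrite lt0n; apply/negP => /eqP z; move: lt; rewrite z mulr0.
      by apply/negP; rewrite -leNgt mulr_ge0// ltW.
    by apply: le_trans (bdF x xg) _; exact: ltW.
  have := card_tiles_capture (@labelled_edge _ G n) wdK wd_size (leqnn _) U.
  rewrite -/good -(ler_nat R) natrD !natrM natr_sum => capt.
  have sumle : e0 / 2 * \sum_(x in good) #|tile (@labelled_edge _ G n) F wd x :&: U|%:R
      <= b * #|` F|%:R * #|V|%:R.
    rewrite mulr_sumr; apply: le_trans (ler_sum _ le) _.
    rewrite sumr_const -[_ *+ _]mulr_natr ler_wpM2l ?ler_nat ?max_card//.
    by rewrite mulr_ge0// ltW.
  have : #|` F|%:R * (dl / 2 * #|V|%:R) < #|` F|%:R * (#|U|%:R - #|~: good|%:R).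
    rewrite ltr_pM2l//; move: badn bigU; lra.
  move: sumle capt; rewrite /b; set s := \sum_(_ in _) _; set f := #|` F|%:R.
  move=> h1 h2 h3; have h4 : f * (dl / 2 * #|V|%:R) < s by lra.
  move: h1; rewrite leNgt => /negP; apply.
  rewrite (_ : _ * _ * _ = e0 / 2 * (f * (dl / 2 * #|V|%:R))); last by field.
  by rewrite ltr_pM2l// divr_gt0.
- exact: ltW.
move=> E [EG Ec EK]; exists E; split=> //; apply: le_trans Ec _; rewrite ler_pM2r//.
suff : D%:R * dl <= e0 / 2 by lra.
rewrite /dl mulrA ler_pdivrMr ?mulr_gt0 ?ltr_wpDl//; nra.
Qed.

Lemma amenable_hyperfinite : hyperfinite R G.
Proof.
(* The minimum with 1 keeps [e0] at most 1/2, so that a connected graph on at least two vertices has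
   as many edges as the padding requires. *)
move=> eps eps0; pose e0 := Num.min eps 1 / 2.
have m0 : 0 < Num.min eps 1 by rewrite lt_min eps0 ltr01.
have e0_gt0 : 0 < e0 by rewrite divr_gt0.
have e0eps : e0 < eps.
  apply: lt_le_trans (_ : Num.min eps 1 <= _); last by rewrite ge_min lexx.
  by rewrite /e0; lra.
have e0half : e0 <= 1 / 2 by rewrite ler_pM2r ?invr_gt0// ge_min lexx orbT.
have [K part] := amenable_partition e0_gt0.
pose nice n (E : {set vtx G n * S * vtx G n}) := E \subset edges (@labelled_edge _ G n) /\ forall x,
  (#|connect (linked (remove_edges (@labelled_edge _ G n) E)) x| <= maxn K 1)%N.
(* The pieces are padded with further edges, up to a fixed proportion, to make
   the proportion of removed edges converge. *)
have padded : \forall n \near \oo, exists E, nice n E /\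
    #|E| = Num.truncn (e0 * #|vtx G n|%:R).
  have big : \forall n \near \oo, (2 <= #|vtx G n|)%N.
    by move/cvgnyPge : (graph_seq_size G); apply.
  apply: filterS (filterI part big) => n [[E [EG Ec EK]] V2].
  have e0V : 0 <= e0 * #|vtx G n|%:R by rewrite mulr_ge0// ltW.
  have [|C [EC CG cC]] := @subset_between _ E _ (Num.truncn (e0 * #|vtx G n|%:R)) EG.
    rewrite truncn_ge_nat// Ec /= -(ler_nat R).
    apply: le_trans (_ : e0 * #|vtx G n|%:R <= _); first by rewrite truncn_le.
    have := connected_card_edges (graph_seq_connected G n) V2.
    rewrite -(ler_nat R) natrM => h; have h0 : 0 <= #|vtx G n|%:R :> R by [].
    by move: h e0half; nra.
  exists C; split=> //; split=> // x; apply: leq_trans (EK x).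
  apply: subset_leq_card; apply/fintype.subsetP => y; apply: connect_sub => u v uv.
  by apply: connect1; exact: cut_sub uv.
have exE n : exists E, nice n E /\ ((exists E, nice n E /\
    #|E| = Num.truncn (e0 * #|vtx G n|%:R)) -> #|E| = Num.truncn (e0 * #|vtx G n|%:R)).
  have [[E [nE cE]]|no] := pselect (exists E, nice n E /\
    #|E| = Num.truncn (e0 * #|vtx G n|%:R)); first by exists E.
  (* At the finitely many indices without a padded set, removing every edge leaves singletons. *)
  exists (edges (@labelled_edge _ G n)); split=> //; split=> // x.
  by rewrite card_connect_no_edges// leq_max orbT.
exists (maxn K 1); split; first by rewrite leq_max orbT.
exists (fun n => sval (cid (exE n))); split.
- by move=> n; case: (svalP (cid (exE n))) => -[].
- exists e0 => //; apply/cvgrPdist_le => e e_gt0.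
  have big : \forall n \near \oo, ((Num.truncn e^-1).+1 <= #|vtx G n|)%N.
    by move/cvgnyPge : (graph_seq_size G); apply.
  apply: filterS (filterI padded big) => n [pn].
  case: (svalP (cid (exE n))) => _ /(_ pn) -> Vn.
  have V0 : 0 < #|vtx G n|%:R :> R by rewrite ltr0n; exact: leq_trans Vn.
  have e0V : 0 <= e0 * #|vtx G n|%:R by rewrite mulr_ge0// ltW.
  have lo : (Num.truncn (e0 * #|vtx G n|%:R))%:R <= e0 * #|vtx G n|%:R by rewrite truncn_le.
  have hi := truncnS_gt (e0 * #|vtx G n|%:R).
  have Ve : 1 <= e * #|vtx G n|%:R.
    rewrite -ler_pdivrMl// mulr1; apply: le_trans (ltW (truncnS_gt _)) _.
    by rewrite ler_nat.
  rewrite -natr1 in hi; rewrite -(ler_pM2r V0) -[X in _ * X <= _](gtr0_norm V0) -normrM mulrBl divfK ?gt_eqF//.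
  by rewrite ger0_norm; lra.
- by move=> n x; case: (svalP (cid (exE n))) => -[_ /(_ x)].
Qed.

End AmenableHyperfinite.

(** * A sofic approximation of the integers without property A *)

Definition mint : Type := int.
HB.instance Definition _ := Choice.copy mint int.
HB.instance Definition _ := @isGroup.Build mint (0 : int) (fun x : int => - x)
  (fun x y : int => x + y) (@addrA int) (@add0r int) (@addr0 int) (@addNr int) (@addrN int).

Definition mint_gen : {fset mint} := [fset (1 : int) : mint]%fset.

Lemma mint_genP (s : mint_gen) : val s = 1 :> int.
Proof. by have := valP s; rewrite inE => /eqP. Qed.

Lemma generates_mint : generates mint_gen.
Proof.
move=> H grpH genH.
have H1 : (1 : int) \in H by apply: genH; rewrite inE.
have Hn (n : nat) : (n%:Z : mint) \in H.
  elim: n => [|n IH]; first exact: grpH.1.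
  have -> : (n.+1%:Z : mint) = ((n%:Z : mint) * (1 : int))%g by rewrite -addn1 PoszD.
  exact: group_closedM.
by move=> [n|n]; [exact: Hn|apply: (group_closedV grpH (Hn n.+1))].
Qed.

(** Averages over an interval of [N] integers: translation by 1 changes only the two end terms, so
    the average moves by at most [1 / N]. *)
Lemma amenable_mint (R : realType) : amenable mint R.
Proof.
apply: (amenable_almost_invariant generates_mint) => eps eps0.
pose N := (Num.truncn eps^-1).+1.
pose f (A : set mint) (i : int) : R := (`[< A i >])%:R.
have f01 A i : 0 <= f A i <= 1 by rewrite /f; case: `[< _ >]; rewrite ?lexx ?ler01.
have N0 : 0 < N%:R :> R by [].
exists (fun A => (\sum_(i < N) f A i%:Z) / N%:R); split.
- move=> A; rewrite divr_ge0// sumr_ge0// => i _; by have /andP[] := f01 A i.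
- rewrite (eq_bigr (fun=> 1)); last by move=> i _; rewrite /f asboolT.
  by rewrite sumr_const card_ord divff ?gt_eqF// lexx andbT gerBl ltW.
- move=> A B AB; rewrite -mulrDl -big_split; congr (_ / _); apply: eq_bigr => i _ /=.
  rewrite /f; have [Aw|nAw] := pselect (A i%:Z); have [Bw|nBw] := pselect (B i%:Z).
  + by have : (A `&` B) i%:Z by []; rewrite AB.
  + by rewrite (asboolT Aw) (asboolF nBw) addr0 asboolT//; left.
  + by rewrite (asboolT Bw) (asboolF nAw) add0r asboolT//; right.
  + by rewrite (asboolF nAw) (asboolF nBw) addr0 asboolF// => -[].
move=> s A; rewrite inE => /eqP ->.
have shift i : f ((fun a : mint => (((1 : int) : mint) * a)%g) @` A) i = f A (i - 1).
  congr (nat_of_bool _)%:R; apply/asboolP/asboolP => [[a Aa <-]|Ai].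
    by rewrite [(_ * _)%g]addrC addrK.
  by exists (i - 1); rewrite // [(_ * _)%g]addrC subrK.
rewrite (eq_bigr _ (fun (i : 'I_N) _ => shift i)) -mulrBl normrM.
have Ni : 0 <= (N%:R : R)^-1 by rewrite invr_ge0.
rewrite (ger0_norm Ni) ler_pdivrMr// /N big_ord_recl big_ord_recr /=.
have -> : \sum_(i < Num.truncn eps^-1) f A ((bump 0 i)%:Z - 1) =
          \sum_(i < Num.truncn eps^-1) f A i.
  by apply: eq_bigr => i _; congr (f A _); rewrite /bump /=; lia.
apply: (@le_trans _ _ 1).
  have := f01 A (0%:Z - 1); have := f01 A (Num.truncn eps^-1).
  set x := f _ _; set y := f A (0%:Z - 1); set z := \sum_(_ < _) _.
  move=> /andP[? ?] /andP[? ?]; rewrite ler_norml; apply/andP; split; lra.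
rewrite -ler_pdivrMl// mulr1; exact: ltW (truncnS_gt _).
Qed.

(** * Finite groups with a long path attached *)

Section Lollipop.
Variables (gT : finGroupType) (a b : gT) (m : nat).
Local Notation vertex := ('I_m.+1 + gT)%type.

Definition gen_edge (x y : gT) : bool := (y == a * x)%g || (y == b * x)%g.

(* a directed path of length [m] leading to the neutral element of the graph of
   left multiplications by [a] and [b] *)
Definition lollipop (s : mint_gen) : rel vertex := fun u v =>
  match u, v with
  | inl i, inl j => j == i.+1 :> nat
  | inl i, inr x => (i == ord_max) && (x == 1%g)
  | inr x, inr y => gen_edge x y
  | inr _, inl _ => false
  end.

Let lab : mint_gen := [` fset11 ((1 : int) : mint)]%fset.

Lemma lollipop_linkedP u v : reflect (lollipop lab u v \/ lollipop lab v u) (linked lollipop u v).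
Proof. by apply: (iffP existsP) => [[s /orP]//|uv]; exists lab; apply/orP. Qed.

Lemma lollipop_degree u : (degree lollipop u <= #|{: mint_gen}| * 6)%N.
Proof.
(* The lists need only contain the neighbours. A meaningless [inord] value, or [inl ord_max] listed
   before every group element, does no harm. *)
pose nexts (u : vertex) : seq vertex := match u with
  | inl i => [:: inl (inord i.+1); inr 1%g]
  | inr x => [:: inr (a * x)%g; inr (b * x)%g] end.
pose prevs (u : vertex) : seq vertex := match u with
  | inl i => [:: inl (inord i.-1)]
  | inr x => [:: inr (a^-1 * x)%g; inr (b^-1 * x)%g; inl ord_max] end.
rewrite /degree -sum_nat_const; apply: leq_sum => s _; rewrite -[6%N]/(3 + 3)%N.
apply: leq_add.
  apply: leq_trans (_ : #|nexts u| <= _)%N; last first.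
    by apply: leq_trans (card_size _) _; case: u.
  apply: subset_leq_card; apply/fintype.subsetP => v; rewrite inE.
  case: u v => [i|x] [j|y] //=.
  - move=> /eqP ji; rewrite !inE; apply/orP; left; apply/eqP; congr inl.
    by apply: val_inj; rewrite /= inordK -ji.
  - by move=> /andP[_ /eqP->]; rewrite !inE eqxx orbT.
  - by move=> /orP[] /eqP->; rewrite !inE eqxx ?orbT.
apply: leq_trans (_ : #|prevs u| <= _)%N; last first.
  by apply: leq_trans (card_size _) _; case: u.
apply: subset_leq_card; apply/fintype.subsetP => v; rewrite inE.
case: u v => [i|x] [j|y] //=.
- move=> /eqP ij; rewrite !inE; apply/eqP; congr inl.
  by apply: val_inj; rewrite /= ij inordK ?ltn_ord.
- by move=> /andP[/eqP-> _]; rewrite !inE eqxx !orbT.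
- by move=> /orP[] /eqP->; rewrite !inE mulKg eqxx ?orbT.
Qed.

Lemma lollipop_connected : (forall x, connect (linked (fun _ : unit => gen_edge)) 1%g x) ->
  connected_graph lollipop.
Proof.
move=> conn; split; first by apply/card_gt0P; exists (inl ord0).
have csym : connect_sym (linked lollipop).
  by apply: sym_connect_sym; exact: linked_sym.
suff to1 u : connect (linked lollipop) (inr 1%g) u.
  by move=> u v; apply: connect_trans (to1 v); rewrite csym.
case: u => [i|x].
  have : connect (linked lollipop) (inr 1%g) (inl ord_max).
    by apply: connect1; apply/lollipop_linkedP; right; rewrite /= !eqxx.
  move=> /connect_trans; apply.
  rewrite csym; have [k] := ubnP (m - i)%N; elim: k i => // k IH i mi.
  have [->|/eqP im] := eqVneq i ord_max; first exact: connect0.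
  have lt : (i.+1 < m.+1)%N.
    by rewrite ltnS ltn_neqAle -ltnS ltn_ord andbT; apply/eqP => E; apply: im; exact: val_inj.
  apply: connect_trans (IH (Ordinal lt) _); last by rewrite /=; move: mi lt; lia.
  by apply: connect1; apply/lollipop_linkedP; left => /=.
have /connectP[p pp ->] := conn x.
elim: p (1%g : gT) pp => [|z p IH] y /=; first by rewrite connect0.
move=> /andP[/existsP[_ yz] /IH]; apply: connect_trans; apply: connect1.
by apply/lollipop_linkedP; exact/orP.
Qed.

End Lollipop.

Lemma cayley_mint_linkedP (g h : mint) :
  reflect (h = g + 1 :> int \/ g = h + 1 :> int) (linked (@cayley _ mint_gen) g h).
Proof.
apply: (iffP existsP) => [[s /orP[]/eqP->]|gh].
- by left; rewrite mint_genP.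
- by right; rewrite mint_genP.
exists [` fset11 ((1 : int) : mint)]%fset; apply/orP.
by case: gh => ->; [left|right]; rewrite /cayley.
Qed.

Section LollipopSofic.
Variables (gT : finGroupType) (a b : gT) (m : nat).
Local Notation G := (@lollipop gT a b m).

(** The bounds keep the ball away from the group part and inside the path, where the coordinate
    [j - i] compares it with the integers. *)
Lemma lollipop_ball r (i : 'I_m.+1) k y : (r <= i)%N -> (i + r < m)%N -> (k <= r)%N ->
  graph_ball G (inl i) k y ->
  exists2 j : 'I_m.+1, y = inl j &
    (`|j%:Z - i%:Z| <= k)%N /\ graph_ball (@cayley _ mint_gen) 1%g k (j%:Z - i%:Z : int).
Proof.
move=> ri irm; elim: k y => [|k IH] y kr.
  move=> /graph_ball_inv[<-|[? _] //]; exists i => //; rewrite subrr.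
  by split; last exact: graph_ball0.
move=> /graph_ball_inv[<-|[z /= zb]].
  exists i => //; rewrite subrr; split=> //.
  exact: graph_ball0.
move=> zy; have [j zj [jk jb]] := IH _ (ltnW kr) zb; rewrite {}zj in zb zy.
have jm : (j < m)%N by move: jk; lia.
have [j' -> jj'] : exists2 j' : 'I_m.+1, y = inl j' & (j' = j.+1 :> nat \/ j = j'.+1 :> nat).
  move: zy => /lollipop_linkedP; case: y => [j'|x] /=.
    by move=> jj'; exists j' => //; case: jj' => /eqP; [left|right].
  by move=> [/andP[/eqP jE]|//]; move: jm; rewrite jE /= ltnn.
exists j' => //; split; first by move: jk; lia.
apply: graph_ball_rcons jb _; apply/cayley_mint_linkedP.
by case: jj' => ->; [left|right]; lia.
Qed.

Lemma lollipop_ball_surj r (i : 'I_m.+1) k (g : mint) :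
  (r <= i)%N -> (i + r < m)%N -> (k <= r)%N ->
  graph_ball (@cayley _ mint_gen) 1%g k g ->
  exists2 j : 'I_m.+1, g = j%:Z - i%:Z :> int &
    (`|j%:Z - i%:Z| <= k)%N /\ graph_ball G (inl i) k (inl j).
Proof.
move=> ri irm; elim: k g => [|k IH] g kr.
  move=> /graph_ball_inv[<-|[? _] //]; exists i => //; first by rewrite subrr.
  by rewrite subrr; split; last exact: graph_ball0.
move=> /graph_ball_inv[<-|[z /= zb]].
  exists i => //; first by rewrite subrr.
  by rewrite subrr; split; last exact: graph_ball0.
move=> /cayley_mint_linkedP zg; have [j zj [jk jb]] := IH _ (ltnW kr) zb.
case: zg => zg; rewrite zj in zg.
  have j'm : (j.+1 < m.+1)%N by move: jk; lia.
  exists (Ordinal j'm) => /=; first by rewrite zg; lia.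
  split; first by move: jk; lia.
  by apply: graph_ball_rcons jb _; apply/lollipop_linkedP; left => /=.
have j0 : (0 < j)%N by move: jk; lia.
have j'm : (j.-1 < m.+1)%N by have := ltn_ord j; lia.
exists (Ordinal j'm) => /=; first by move: zg j0; set t : int := g; lia.
split; first by move: jk; lia.
by apply: graph_ball_rcons jb _; apply/lollipop_linkedP; right => /=; rewrite prednK.
Qed.

Lemma lollipop_iso_balls r (i : 'I_m.+1) : (r <= i)%N -> (i + r < m)%N ->
  iso_balls G (@cayley _ mint_gen) r (inl i) 1%g.
Proof.
move=> ri irm.
(* The value 0 on the group part is a mere default, as the ball does not meet it. *)
exists (fun v : 'I_m.+1 + gT => match v with inl j => j%:Z - i%:Z | inr _ => 0 end : int); split.
- by rewrite subrr.
- split.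
  + by move=> y /(lollipop_ball ri irm (leqnn r))[j -> []].
  + move=> y z /mem_set; rewrite !inE => /(lollipop_ball ri irm (leqnn r))[j -> _].
    move=> /(lollipop_ball ri irm (leqnn r))[j' -> _] E; congr inl; apply: val_inj => /=.
    by move: E; lia.
  + move=> g /(lollipop_ball_surj ri irm (leqnn r))[j gE [_ jb]].
    by exists (inl j).
move=> s y z /(lollipop_ball ri irm (leqnn r))[j -> _].
move=> /(lollipop_ball ri irm (leqnn r))[j' -> _] /=.
rewrite /cayley mint_genP.
change ((j' == j.+1 :> nat) = (j'%:Z - i%:Z == j%:Z - i%:Z + 1 :> int)).
by apply/eqP/eqP; lia.
Qed.

(** The path positions from [r] to [m - r - 1] are all good. *)
Lemma lollipop_card_good r :
  (m <= #|[pred x | `[< iso_balls G (@cayley _ mint_gen) r x 1%g >]]| + 2 * r)%N.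
Proof.
pose f (t : 'I_(m - 2 * r)) : 'I_m.+1 + gT := inl (inord (r + t)).
have fK (t : 'I_(m - 2 * r)) : (inord (r + t) : 'I_m.+1) = (r + t)%N :> nat.
  by rewrite inordK//; have := ltn_ord t; lia.
have finj : injective f.
  by move=> t t' [/(congr1 val)]; rewrite /= !fK => /addnI E; apply: val_inj.
suff : (#|[set f t | t : 'I_(m - 2 * r)]%SET| <=
    #|[pred x | `[< iso_balls G (@cayley _ mint_gen) r x 1%g >]]|)%N.
  by rewrite card_imset// card_ord; lia.
apply: subset_leq_card; apply/fintype.subsetP => _ /imsetP[t _ ->]; apply/asboolP.
by apply: lollipop_iso_balls; rewrite fK; have := ltn_ord t; lia.
Qed.

End LollipopSofic.

(** Reindexing the sum over [x] by [g] changes the mean of [c] by at most [eps * #|gT|], and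
    reindexing twice by at most double that. The three means sum to at most [#|gT|] by
    disjointness. *)
Lemma three_disjoint_shifts (R : realType) (gT : finGroupType) (V : finType)
    (xi : gT -> V -> R) (c : gT -> V -> bool) (g : gT) (eps : R) :
  (forall x y, 0 <= xi x y) -> (forall x, \sum_y xi x y = 1) ->
  (forall x, \sum_y `|xi x y - xi (g * x)%g y| <= eps) ->
  (forall x y, xi x y != 0 -> (c x y + c (g * x)%g y + c (g * (g * x))%g y <= 1)%N) ->
  3 * \sum_x \sum_y xi x y * (c x y)%:R <= (1 + 3 * eps) * #|gT|%:R.
Proof.
move=> xi0 xi1 xig disj.
pose mean (d : gT -> V -> bool) := \sum_x \sum_y xi x y * (d x y)%:R.
have w01 (d : gT -> V -> bool) x x' : 0 <= \sum_y xi x y * (d x' y)%:R <= 1.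
  apply/andP; split; first by apply: sumr_ge0 => y _; rewrite mulr_ge0.
  by rewrite -[leRHS](xi1 x); apply: ler_sum => y _; case: (d x' y); rewrite ?mulr1 ?mulr0.
have step d : `|mean (fun x => d (g * x)%g) - mean d| <= eps * #|gT|%:R.
  have ginj : {in [set: gT]%SET &, injective (fun x => (g * x)%g)} by move=> x y _ _ /mulgI.
  have := @sum_shift_bound R gT _ _ (fun x => \sum_y xi x y * (d x y)%:R)
    (fun x => \sum_y xi x y * (d (g * x)%g y)%:R) (fun=> eps) ginj
    (fun x => w01 d x x) (fun x => w01 d x (g * x)%g).
  rewrite sumr_const cardsT finset.setCT cards0 addr0 mulr_natr; apply => x _.
  rewrite -sumrB; apply: le_trans (ler_norm_sum _ _ _) _; apply: le_trans (xig x).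
  apply: ler_sum => y _; rewrite -mulrBl normrM ler_piMr//.
  by case: (d _ _); rewrite ?normr1 ?normr0.
have := step c; have := step (fun x => c (g * x)%g).
have : mean c + mean (fun x => c (g * x)%g) + mean (fun x => c (g * (g * x))%g) <= #|gT|%:R.
  rewrite /mean -!big_split /= -sum1_card natr_sum; apply: ler_sum => x _.
  rewrite -!big_split /= -[leRHS](xi1 x); apply: ler_sum => y _.
  have [->|/disj] := eqVneq (xi x y) 0; first by rewrite !mul0r !addr0.
  rewrite -!mulrDr -!natrD -(ler_nat R) => le1; exact: ler_piMr.
rewrite -/(mean c); set s := mean c; rewrite !ler_norml => h /andP[h1 _] /andP[h2 _].
lra.
Qed.

(** * Ping-pong for two unipotent matrices over a finite ring *)

Section UnipotentPermutations.
Variable n : nat.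
Local Notation Zp := 'Z_(n.+2).
Local Notation T := (Zp * Zp)%type.

Let sa (v : T) : T := (v.1 + v.2 *+ 3, v.2).
Let sb (v : T) : T := (v.1, v.2 + v.1 *+ 3).

Let sa_inj : injective sa.
Proof.
move=> [u v] [u' v'] E; have Ev : v = v' := congr1 snd E.
by have : u + v *+ 3 = u' + v' *+ 3 := congr1 fst E; rewrite Ev => /addIr ->.
Qed.

Let sb_inj : injective sb.
Proof.
move=> [u v] [u' v'] E; have Eu : u = u' := congr1 fst E.
by have : v + u *+ 3 = v' + u' *+ 3 := congr1 snd E; rewrite Eu => /addIr ->.
Qed.

Definition perm_a : {perm T} := perm sa_inj.
Definition perm_b : {perm T} := perm sb_inj.

Definition unip := subg_of <<[set perm_a; perm_b]%SET>>%G.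

Definition unip_a : unip := subg _ perm_a.
Definition unip_b : unip := subg _ perm_b.

Let val_a : sgval unip_a = perm_a.
Proof. by rewrite subgK// mem_gen// !inE eqxx. Qed.

Let val_b : sgval unip_b = perm_b.
Proof. by rewrite subgK// mem_gen// !inE eqxx orbT. Qed.

Lemma unip_connected x : connect (linked (fun _ : unit => gen_edge unip_a unip_b)) 1%g x.
Proof.
(* In a finite group every element is a product of generators without inverses; each left factor is
   then one edge. *)
have [k [c cA xE]] := gen_prodgP (valP x).
have -> : x = subg _ (\prod_(i < k) c i)%g by rewrite -xE; exact/esym/sgvalK.
elim: k c cA {xE} => [|k IH] c cA.
  rewrite big_ord0 (_ : subg _ 1%g = 1%g) ?connect0//.
  by apply: val_inj; rewrite subgK ?group1.
have mem_c i : c i \in <<[set perm_a; perm_b]%SET>>%g by apply: mem_gen; exact: cA.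
rewrite big_ord_recl subgM ?group_prod//; apply: connect_trans (IH (fun i => c (lift ord0 i)) _) _.
  by move=> i; exact: cA.
apply: connect1; apply/existsP; exists tt; apply/orP; left; rewrite /gen_edge.
by have := cA ord0; rewrite !inE => /orP[]/eqP ->; rewrite eqxx ?orbT.
Qed.

Definition red (i j : int) : T := (i%:~R, j%:~R).

Let aE i j : perm_a (red i j) = red (i + 3 * j) j.
Proof. by rewrite permE /sa /red /= intrD intrM mulr_natl. Qed.

Let bE i j : perm_b (red i j) = red i (j + 3 * i).
Proof. by rewrite permE /sb /red /= intrD intrM mulr_natl. Qed.

Let aVE i j : (perm_a^-1)%g (red i j) = red (i - 3 * j) j.
Proof. by apply: (@perm_inj _ perm_a); rewrite permKV aE subrK. Qed.

Let bVE i j : (perm_b^-1)%g (red i j) = red i (j - 3 * i).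
Proof. by apply: (@perm_inj _ perm_b); rewrite permKV bE subrK. Qed.

(* The action of [h x^-1]; replacing [x] by [a x] applies [a^-1] to the result. *)
Definition disp (x h : unip) (v : T) : T := (sgval h * (sgval x)^-1)%g v.

(** The path is collapsed to the neutral element, where it is attached, so that its edges act
    trivially. *)
Definition lolli_proj m (y : 'I_m.+1 + unip) : unip :=
  match y with inl _ => 1%g | inr h => h end.

(** Each edge acts by the identity, a shear or its inverse. These are invertible over the integers,
    so a nonzero lift stays nonzero, and entries grow at most by the factor [1 + 3]. *)
Lemma lollipop_disp m k (x : unip) y :
  graph_ball (@lollipop _ unip_a unip_b m) (inr x) k y ->
  forall i j M, (`|i| <= M)%N -> (`|j| <= M)%N -> (i, j) != (0, 0) ->
  exists i' j', [/\ (`|i'| <= 4 ^ k * M)%N, (`|j'| <= 4 ^ k * M)%N, (i', j') != (0, 0)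
    & disp x (lolli_proj y) (red i j) = red i' j'].
Proof.
have base i j M l : (`|i| <= M)%N -> (`|j| <= M)%N -> (i, j) != (0, 0) ->
  exists i' j', [/\ (`|i'| <= 4 ^ l * M)%N, (`|j'| <= 4 ^ l * M)%N, (i', j') != (0, 0)
    & disp x x (red i j) = red i' j'].
  move=> iM jM ij; have pos : (0 < 4 ^ l)%N by rewrite expn_gt0.
  exists i, j; split=> //; first by apply: leq_trans iM _; rewrite leq_pmull.
    by apply: leq_trans jM _; rewrite leq_pmull.
  by rewrite /disp mulgV perm1.
elim: k y => [|k IH] y /graph_ball_inv.
  by move=> [<-|[? _] //] i j M iM jM ij; exact: base.
move=> [<-|[z zb /= zy]] i j M iM jM ij; first exact: base.
(* Permutations compose from left to right, so the last edge acts first, and the induction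
   hypothesis is applied to the vector it yields. *)
pose g := (sgval (lolli_proj y) * (sgval (lolli_proj z))^-1)%g.
suff [i1 [j1 [i1M j1M ij1 gE]]] : exists i1 j1, [/\ (`|i1| <= 4 * M)%N, (`|j1| <= 4 * M)%N,
    (i1, j1) != (0, 0) & g (red i j) = red i1 j1].
  have [i' [j' [i'M j'M ij' E]]] := IH _ zb _ _ _ i1M j1M ij1.
  exists i', j'; rewrite expnSr -mulnA; split=> //; rewrite -E -gE /disp /g -permM.
  by congr (fun_of_perm _ _); rewrite !mulgA mulgVK.
have gP : g \in [:: 1; perm_a; perm_b; perm_a^-1; perm_b^-1]%g.
  rewrite /g; move: zy => /lollipop_linkedP; case: z y {zb g} => [?|z] [?|y] /=.
  - by move=> _; rewrite mulgV !inE eqxx.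
  - by move=> [/andP[_ /eqP->]|//]; rewrite mulgV !inE eqxx.
  - by move=> [//|/andP[_ /eqP->]]; rewrite mulgV !inE eqxx.
  - move=> [/orP[]/eqP->|/orP[]/eqP->]; rewrite /= ?val_a ?val_b ?invgM ?mulgK;
      by rewrite ?[(sgval y * _)%g]mulgA ?mulgV ?mul1g !inE eqxx ?orbT.
move: ij; rewrite !xpair_eqE !negb_and => ij.
move: gP; rewrite !inE => /orP[/eqP->|/orP[/eqP->|/orP[/eqP->|/orP[]/eqP->]]].
- by exists i, j; rewrite perm1; split=> //; move: ij; rewrite ?xpair_eqE; lia.
- by exists (i + 3 * j), j; rewrite aE; split=> //; move: ij; rewrite ?xpair_eqE; lia.
- by exists i, (j + 3 * i); rewrite bE; split=> //; move: ij; rewrite ?xpair_eqE; lia.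
- by exists (i - 3 * j), j; rewrite aVE; split=> //; move: ij; rewrite ?xpair_eqE; lia.
- by exists i, (j - 3 * i); rewrite bVE; split=> //; move: ij; rewrite ?xpair_eqE; lia.
Qed.

(* absolute value of the representative of [v] of least absolute value *)
Definition lift_abs (v : Zp) : nat := minn v (n.+2 - v).

Lemma lift_absE (i : int) : (2 * `|i| < n.+2)%N -> lift_abs i%:~R = `|i|%N.
Proof.
move=> small; rewrite /lift_abs; case: i small => k small.
  rewrite -pmulrn /= val_Zp_nat// modn_small; last by move: small; rewrite /=; lia.
  by move: small; rewrite /=; lia.
rewrite NegzE mulrNz -pmulrn /= val_Zp_nat//; move: small; rewrite NegzE /= => small.
rewrite (_ : (Zp_trunc n.+2).+2 = n.+2)//.
by rewrite (@modn_small k.+1) ?modn_small; lia.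
Qed.

Let le12 (v : T) := (lift_abs v.1 <= lift_abs v.2)%N.
Let le21 (v : T) := (lift_abs v.2 <= lift_abs v.1)%N.

(** Any two of [i], [i - 3 j], [i - 6 j] differ by at least [3 |j|], so they cannot both be bounded
    by [|j|] unless [i] and [j] vanish. All are at most [7 M] in absolute value, small enough for
    [lift_abs] to be exact. *)
Let disjoint_a i j M : (`|i| <= M)%N -> (`|j| <= M)%N -> (14 * M < n.+2)%N -> (i, j) != (0, 0) ->
  (le12 (red i j) + le12 (perm_a^-1 (red i j)) + le12 (perm_a^-1 (perm_a^-1 (red i j))) <= 1)%N%g.
Proof.
move=> iM jM Mn; rewrite xpair_eqE negb_and => ij.
by rewrite !aVE /le12 /= !lift_absE; lia.
Qed.

Let disjoint_b i j M : (`|i| <= M)%N -> (`|j| <= M)%N -> (14 * M < n.+2)%N -> (i, j) != (0, 0) ->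
  (le21 (red i j) + le21 (perm_b^-1 (red i j)) + le21 (perm_b^-1 (perm_b^-1 (red i j))) <= 1)%N%g.
Proof.
move=> iM jM Mn; rewrite xpair_eqE negb_and => ij.
by rewrite !bVE /le21 /= !lift_absE; lia.
Qed.

(* The translates by [1], [a^-1], [a^-2] of the cone [|i| <= |j|] in [Z^2] are
   disjoint, and so are those of [|j| <= |i|] under the powers of [b]; but the
   two cones cover. *)
Lemma lollipop_no_vertexwise_propertyA (R : realType) m S0
    (xi : 'I_m.+1 + unip -> 'I_m.+1 + unip -> R) :
  (14 * 4 ^ S0 < n.+2)%N ->
  (forall x z, 0 <= xi x z) -> (forall x, \sum_z xi x z = 1) ->
  (forall x z, xi x z != 0 -> graph_ball (@lollipop _ unip_a unip_b m) x S0 z) ->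
  (forall s x y, @lollipop _ unip_a unip_b m s x y -> \sum_z `|xi x z - xi y z| <= 1 / 7) ->
  False.
Proof.
move=> big xi0 xi1 xiB xiE.
(* The cones are tested on the image of the fixed vector [(1, 0)], which has a small nonzero lift
   for all [y] in the support. *)
pose c (P : T -> bool) (x : unip) (y : 'I_m.+1 + unip) := P (disp x (lolli_proj y) (red 1 0)).
have lab : mint_gen := [` fset11 ((1 : int) : mint)]%fset.
have dispM (g x h : unip) v : disp (g * x)%g h v = (sgval g)^-1%g (disp x h v).
  by rewrite /disp /= invgM mulgA permM.
have reach x y : xi (inr x) y != 0 -> exists i j, [/\ (`|i| <= 4 ^ S0)%N, (`|j| <= 4 ^ S0)%N,
    (i, j) != (0, 0) & disp x (lolli_proj y) (red 1 0) = red i j].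
  move=> /xiB/lollipop_disp/(_ 1 0 1%N) [//|//|//|i [j]]; rewrite muln1 => ij.
  by exists i, j.
have H1 := @three_disjoint_shifts R unip _ (fun x => xi (inr x)) (c le12) unip_a (1 / 7)
  (fun x => xi0 (inr x)) (fun x => xi1 (inr x)).
have {}H1 := H1 (fun x => xiE lab (inr x) (inr (unip_a * x)%g) (introT orP (or_introl (eqxx _)))).
have H2 := @three_disjoint_shifts R unip _ (fun x => xi (inr x)) (c le21) unip_b (1 / 7)
  (fun x => xi0 (inr x)) (fun x => xi1 (inr x)).
have {}H2 := H2 (fun x => xiE lab (inr x) (inr (unip_b * x)%g) (introT orP (or_intror (eqxx _)))).
have {}H1 := H1 _; have {}H2 := H2 _.
have h0 : 0 < #|unip|%:R :> R by rewrite ltr0n; apply/card_gt0P; exists 1%g.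
(* Each cone has average weight at most [(1 + 3 / 7) / 3 = 10 / 21], too little for the two to
   cover. *)
suff cover : #|unip|%:R <= \sum_(x : unip) \sum_y xi (inr x) y * (c le12 x y)%:R +
    \sum_(x : unip) \sum_y xi (inr x) y * (c le21 x y)%:R.
  have {}H1 : 3 * \sum_(x : unip) \sum_y xi (inr x) y * (c le12 x y)%:R
      <= (1 + 3 * (1 / 7)) * #|unip|%:R.
    apply: H1 => x y /reach[i [j [iM jM ij E]]].
    by rewrite /c !dispM val_a E; exact: disjoint_a iM jM big ij.
  have {}H2 : 3 * \sum_(x : unip) \sum_y xi (inr x) y * (c le21 x y)%:R
      <= (1 + 3 * (1 / 7)) * #|unip|%:R.
    apply: H2 => x y /reach[i [j [iM jM ij E]]].
    by rewrite /c !dispM val_b E; exact: disjoint_b iM jM big ij.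
  by lra.
rewrite -sum1_card natr_sum -big_split; apply: ler_sum => x _ /=.
rewrite -[leLHS](xi1 (inr x)) -big_split; apply: ler_sum => y _ /=.
rewrite -mulrDr -natrD ler_peMr// ler1n /c /le12 /le21.
set v := disp _ _ _; rewrite addn_gt0.
by have /orP[->|->] := leq_total (lift_abs v.1) (lift_abs v.2); rewrite ?orbT.
Qed.

End UnipotentPermutations.

(** The factor [n.+1] makes the group part a vanishing proportion of the vertices, invisible in the
    limit. *)
Definition tail_length n : nat := n.+1 * #|unip n|.

Lemma card_unip_gt0 n : (0 < #|unip n|)%N.
Proof. by apply/card_gt0P; exists 1%g. Qed.

Definition lollipops : graph_seq mint_gen.
Proof.
refine (@GraphSeq mint_gen (fun n => 'I_(tail_length n).+1 + unip n)%type
  (fun n => @lollipop _ (unip_a n) (unip_b n) (tail_length n)) _ _ _).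
- by move=> n; apply: lollipop_connected; exact: unip_connected.
- by exists (#|{: mint_gen}| * 6)%N => n x; exact: lollipop_degree.
apply/cvgnyPge => A; exists A => // n /= An.
rewrite card_sum card_ord /tail_length.
have := card_unip_gt0 n; nia.
Defined.

Lemma lollipops_sofic (R : realType) : sofic_approximation R lollipops.
Proof.
move=> r; apply/cvgrPdist_le => e e0.
have big : \forall n \near \oo, ((2 * r + 2) * (Num.truncn e^-1).+1 <= n)%N.
  by exists ((2 * r + 2) * (Num.truncn e^-1).+1)%N.
apply: filterS big => n nbig.
set g := #|[pred x | _]|; have gle : (g <= #|vtx lollipops n|)%N by exact: max_card.
have gge : (tail_length n <= g + 2 * r)%N by exact: lollipop_card_good.
have Vn : #|vtx lollipops n| = ((tail_length n).+1 + #|unip n|)%N.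
  by rewrite card_sum card_ord.
have V0 : 0 < #|vtx lollipops n|%:R :> R by rewrite ltr0n Vn.
rewrite -(ler_pM2r V0) -[X in _ * X <= _](gtr0_norm V0) -normrM mulrBl mul1r divfK ?gt_eqF//.
rewrite -natrB// ger0_norm//.
(* At most [1 + #|unip n| + 2 r] vertices are bad, hence at most [2 r + 2] times [#|unip n|],
   against more than [n + 1] times [#|unip n|] vertices in all. *)
have h : ((#|vtx lollipops n| - g) * (Num.truncn e^-1).+1 <= #|vtx lollipops n|)%N.
  apply: (@leq_trans ((2 * r + 2) * #|unip n| * (Num.truncn e^-1).+1)%N).
    rewrite leq_mul2r; apply/orP; right; have := card_unip_gt0 n; move: gge; rewrite Vn.
    by set u := #|unip n|; nia.
  rewrite Vn /tail_length; have := leq_mul nbig (leqnn #|unip n|).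
  by set t := _.+1; set u := #|unip n|; nia.
rewrite -(ler_nat R) natrM in h.
rewrite mulrC -ler_pdivrMr//; apply: le_trans h.
by rewrite ler_wpM2l// ltW// truncnS_gt.
Qed.

Lemma lollipops_not_propertyA (R : realType) : ~ propertyA R lollipops.
Proof.
move=> pA; have e0 : 0 < 1 / 7 :> R by [].
have [S0 [xi [xi0 xi1 xiB xiE]]] := propertyA_vertexwise pA e0.
(* Property A fixes [S0] independently of [n], so the modulus [n.+2] can be chosen too large for
   lifts within radius [S0] to wrap around. *)
pose n := (14 * 4 ^ S0)%N.
apply: (lollipop_no_vertexwise_propertyA (n := n) _ (xi0 n) (xi1 n) (xiB n) (xiE n)).
by rewrite /n; lia.
Qed.

Theorem theorem0p6 (R : realType) :
  ((forall (Gam : groupType) (S : {fset Gam}) (G : graph_seq S),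
      generates S -> sofic_approximation R G ->
      propertyA R G -> amenable Gam R)
   /\
   (exists (Gam : groupType) (S : {fset Gam}) (G : graph_seq S),
      [/\ generates S, sofic_approximation R G,
          amenable Gam R & ~ propertyA R G]))
  /\
  ((forall (Gam : groupType) (S : {fset Gam}) (G : graph_seq S),
      generates S -> sofic_approximation R G ->
      hyperfinite R G -> amenable Gam R)
   /\
   (forall (Gam : groupType) (S : {fset Gam}) (G : graph_seq S),
      generates S -> sofic_approximation R G ->
      amenable Gam R -> hyperfinite R G)).
Proof.
split; split.
- move=> Gam S G gen sof /propertyA_almost; exact: almost_propertyA_amenable.
- exists mint, mint_gen, lollipops; split.
  + exact: generates_mint.
  + exact: lollipops_sofic.
  + exact: amenable_mint.
  + exact: lollipops_not_propertyA.
- move=> Gam S G gen sof /hyperfinite_almost; exact: almost_propertyA_amenable.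
- move=> Gam S G; exact: amenable_hyperfinite.
Qed.
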